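(* Let $p$ be a prime, let $G$ be a profinite group and let $S$ be a Sylow pro-$p$ subgroup of $G$. Then there is a ring isomorphism $$H^*_c(G;\mathbb{F}_p)\cong H^*_c(S;\mathbb{F}_p)^{\mathcal{F}_S(G)}.$$
   Context: Subgroups of profinite groups are closed. $H^*_c(\cdot;\mathbb{F}_p)$ is the continuous mod-$p$ cohomology ring with trivial coefficients. $\mathcal{F}_S(G)$ is the category whose objects are the closed subgroups of $S$ and whose morphisms $P\to Q$ are the homomorphisms $c_g:x\mapsto gxg^{-1}$ with $g\in G$ and $gPg^{-1}\le Q$. For $\mathcal{F}=\mathcal{F}_S(G)$, $H^*_c(S;\mathbb{F}_p)^{\mathcal{F}}$ is the subring of stable elements, i.e. those $x\in H^*_c(S;\mathbb{F}_p)$ such that $\varphi^*(x)=\mathrm{res}^S_P(x)$ for every closed subgroup $P\le S$ and every $\mathcal{F}$-morphism $\varphi:P\to S$. *)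

(* Defs.v *)
From HB Require Import structures.
From mathcomp Require Import all_boot all_order all_algebra ring_quotient zify.
From mathcomp Require Import all_classical topology.

Set Implicit Arguments.
Unset Strict Implicit.
Unset Printing Implicit Defensive.

Import GRing.Theory.

Local Open Scope classical_set_scope.
Local Open Scope ring_scope.
Local Open Scope quotient_scope.

HB.mixin Record isTopologicalGroup G of Group G & Topological G := {
  mulg_continuous : continuous (fun x : G * G => (x.1 * x.2)%g);
  invg_continuous : continuous (fun x : G => (x^-1)%g)
}.

#[short(type="topologicalGroupType")]
HB.structure Definition TopologicalGroup :=
  {G of Group G & Topological G & isTopologicalGroup G}.

#[short(type="continuousHomType")]
HB.structure Definition ContinuousHom (G H : topologicalGroupType) :=
  {f of @isContinuous G H f & isMultiplicative G H f}.

Definition subgroup (G : topologicalGroupType) (U : set G) : Prop :=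
  group_closed [in U].

Definition normal_subgroup (G : topologicalGroupType) (U : set G) : Prop :=
  subgroup U /\ forall g u : G, U u -> U (g * u * g^-1)%g.

Definition has_index (G : topologicalGroupType) (U : set G) (n : nat) : Prop :=
  ([set [set (g * u)%g | u in U] | g in [set: G]] #= `I_n)%card.

Definition profinite (G : topologicalGroupType) : Prop :=
  [/\ compact [set: G], hausdorff_space G & totally_disconnected [set: G]].

Definition pro_p (p : nat) (G : topologicalGroupType) : Prop :=
  profinite G /\
  forall U : set G, open U -> normal_subgroup U ->
    exists k : nat, has_index U (p ^ k).

Record closedSubgroup (G : topologicalGroupType) := ClosedSubgroup {
  closedSubgroup_set :> set G;
  closedSubgroup_subgroup : subgroup closedSubgroup_set;
  closedSubgroup_closed : closed closedSubgroup_set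
}.

Lemma continuous_pair (T U V : topologicalType) (f : T -> U) (g : T -> V) :
  continuous f -> continuous g -> continuous (fun x => (f x, g x)).
Proof. by move=> cf cg x; apply: cvg_pair; [exact: cf|exact: cg]. Qed.

Lemma continuous_mulg (T : topologicalType) (G : topologicalGroupType)
    (f g : T -> G) :
  continuous f -> continuous g -> continuous (fun x => f x * g x)%g.
Proof.
move=> cf cg x; apply: (continuous_comp (f := fun x => (f x, g x))
                            (g := fun y : G * G => (y.1 * y.2)%g)).
  exact: continuous_pair.
exact: mulg_continuous.
Qed.

Section SubgroupType.
Variables (G : topologicalGroupType) (S : closedSubgroup G).

HB.instance Definition _ := SubChoice.copy (set_type S)
  {x : G | x \in closedSubgroup_set S}.
HB.instance Definition _ := SubChoice_isSubGroup.Build G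
  [in closedSubgroup_set S] (set_type S) (closedSubgroup_subgroup S).

Lemma subgroup_val_continuous : continuous (fun x : S => \val x : G).
Proof. exact: initial_continuous. Qed.

Lemma continuous_subgroup (T : topologicalType) (f : T -> S) :
  continuous (fun x => \val (f x) : G) -> continuous f.
Proof. exact: continuous_comp_initial. Qed.

Lemma subgroup_mulg_continuous : continuous (fun x : S * S => (x.1 * x.2)%g).
Proof.
apply: continuous_subgroup.
rewrite (_ : (fun x => _) = fun x : S * S => (\val x.1 * \val x.2)%g).
  apply: continuous_mulg => x; apply: continuous_comp.
  - exact: cvg_fst.
  - exact: subgroup_val_continuous.
  - exact: cvg_snd.
  - exact: subgroup_val_continuous.
by apply/funext => x; rewrite gmulfM.
Qed.

Lemma subgroup_invg_continuous : continuous (fun x : S => (x^-1)%g).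
Proof.
apply: continuous_subgroup.
rewrite (_ : (fun x => _) = fun x : S => ((\val x)^-1)%g).
  move=> x; apply: (continuous_comp (f := fun x : S => \val x : G)
                                    (g := fun y : G => (y^-1)%g)).
    exact: subgroup_val_continuous.
  exact: invg_continuous.
by apply/funext => x.
Qed.

HB.instance Definition _ := isTopologicalGroup.Build (set_type S)
  subgroup_mulg_continuous subgroup_invg_continuous.

End SubgroupType.

(* The second clause says that p does not divide the supernatural number       *)
(* [G : S], the lcm of the indices [G : U] of the open subgroups U of G that   *)
(* contain S.                                                                  *)
Definition sylow (p : nat) (G : topologicalGroupType) (S : closedSubgroup G)
    : Prop :=
  pro_p p S /\
  forall U : set G, open U -> subgroup U -> S `<=` U ->
    exists2 n : nat, has_index U n & ~~ (p %| n)%N.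

(* An inhomogeneous cochain is encoded as a function on words in G: its        *)
(* component of degree n is its restriction to the words of length n.          *)
Section BarFunctions.
Variables (G : groupType) (R : nzRingType).
Implicit Types (f g h : seq G -> R) (s : seq G).

(* On a word [:: x_1; ...; x_n], face 0 drops x_1, face i with 0 < i < n       *)
(* replaces x_i, x_(i+1) by their product, and face n drops x_n.               *)
Fixpoint face (i : nat) (s : seq G) {struct s} : seq G :=
  match i, s with
  | 0, _ => behead s
  | 1, x :: y :: s' => (x * y)%g :: s'
  | i'.+1, x :: ((_ :: _) as s') => x :: face i' s'
  | _.+1, _ => [::]
  end.

(* The inhomogeneous differential for trivial coefficients.                    *)
Definition bar_diff f s : R :=
  if s is [::] then 0 else
  \sum_(i < (size s).+1) (-1) ^+ i * f (face i s).

(* The sign convention is the one without the factor (-1)^(pq) in degree p + q. *)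
Definition cup f g s : R :=
  \sum_(i < (size s).+1) f (take i s) * g (drop i s).

Definition cup1 s : R := (s == [::])%:R.

Lemma size_face i s : size (face i s) = (size s).-1.
Proof.
elim: s i => [|x [|y s] IH] [|[|i]] //=.
by have := IH i.+1; case: s {IH} => [|? ?] //= ->.
Qed.

Lemma nth_face i s j : (i <= size s)%N -> (j < (size s).-1)%N ->
  nth 1%g (face i s) j =
    if (j.+1 < i)%N then nth 1%g s j
    else if j.+1 == i then (nth 1 s j * nth 1 s j.+1)%g
    else nth 1%g s j.+1.
Proof.
elim: s i j => [|x [|y s] IH] [|[|i]] [|j] //= Hi Hj.
by rewrite (IH i.+1 j).
Qed.

Lemma face_face i j s : (i < j)%N -> (j <= size s)%N -> (1 < size s)%N ->
  face i (face j s) = face j.-1 (face i s).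
Proof.
move=> ij js s1; apply: (@eq_from_nth G 1%g) => [|k]; rewrite !size_face // => Hk.
rewrite !nth_face ?size_face; try lia.
repeat case: ifP; move=> *; rewrite ?nth_face ?size_face; try lia.
all: repeat (case: ifP => ?); try lia; rewrite ?mulgA //.
all: try by do ? congr (_ * _)%g; congr nth; lia.
all: congr nth; lia.
Qed.

Lemma sum_simplicial (a : nat -> nat -> R) n :
  (forall i j, (i < j)%N -> (j <= n)%N -> a i j = a j.-1 i) ->
  \sum_(j < n.+1) \sum_(i < n) (-1) ^+ (i + j) * a i j = 0.
Proof.
elim: n => [|n IH] H.
  by rewrite big1 // => j _; rewrite big_ord0.
rewrite big_ord_recr /=.
under eq_bigr do rewrite big_ord_recr /=.
rewrite big_split /= IH ?add0r; last by move=> i j ij jn; apply: H => //; lia.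
rewrite -big_split big1 // => i _ /=.
rewrite [a i n.+1]H //=.
by rewrite addnS exprS mulN1r mulNr [(n + i)%N]addnC subrr.
Qed.

Lemma bar_diffK f s : bar_diff (bar_diff f) s = 0.
Proof.
case: s => [|x [|y s]] //.
  by rewrite /bar_diff big1 // => -[[|[|i]] ?] _; rewrite mulr0.
set t := x :: y :: s.
have E i : bar_diff f (face i t) =
   \sum_(i0 < (size t)) (-1) ^+ i0 * f (face i0 (face i t)).
  by rewrite /bar_diff; case: (face i t) (size_face i t) => //= ? l ->.
transitivity (\sum_(j < (size t).+1) (-1) ^+ j * bar_diff f (face j t)) => //.
rewrite -[RHS](sum_simplicial (a := fun i j => f (face i (face j t))) (n := size t)); last first.
  by move=> i j ij jt; rewrite face_face.
apply: eq_bigr => j _.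
rewrite E mulr_sumr; apply: eq_bigr => i _.
by rewrite mulrA -exprD addnC.
Qed.

Definition gsign f s : R := (-1) ^+ size s * f s.

Lemma take_face i j s : (i <= j)%N -> (j < size s)%N  ->
  take j (face i s) = face i (take j.+1 s).
Proof.
move=> ij js.
apply: (@eq_from_nth G 1%g) => [|k].
  by rewrite size_face !size_take_min size_face; lia.
rewrite size_take_min size_face => Hk.
have kj: (k < j)%N by move: Hk; lia.
rewrite nth_take // !nth_face ?size_take_min; try lia.
by rewrite !nth_take; try lia.
Qed.

Lemma take_face_gt i j s : (j < i)%N -> (i <= size s)%N ->
  take j (face i s) = take j s.
Proof.
move=> ij js.
apply: (@eq_from_nth G 1%g) => [|k].
  by rewrite !size_take_min size_face; lia.
rewrite size_take_min size_face => Hk.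
have kj: (k < j)%N by move: Hk; lia.
rewrite !nth_take // nth_face; try lia.
by rewrite ifT //; lia.
Qed.

Lemma drop_face i j s : (i <= j)%N -> (j < size s)%N ->
  drop j (face i s) = drop j.+1 s.
Proof.
move=> ij js.
apply: (@eq_from_nth G 1%g) => [|k].
  by rewrite !size_drop size_face; lia.
rewrite size_drop size_face => Hk.
rewrite !nth_drop // nth_face; try lia.
rewrite !ifF; try lia. congr nth; lia.
Qed.

Lemma drop_face_gt i j s : (j < i)%N -> (i <= size s)%N ->
  drop j (face i s) = face (i - j) (drop j s).
Proof.
move=> ij js.
apply: (@eq_from_nth G 1%g) => [|k].
  by rewrite size_face !size_drop size_face; lia.
rewrite size_drop size_face => Hk.
rewrite !nth_drop // !nth_face ?size_drop; try lia.
rewrite !nth_drop.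
have -> : ((j + k).+1 < i)%N = (k.+1 < i - j)%N by lia.
have -> : ((j + k).+1 == i)%N = (k.+1 == i - j)%N by lia.
by rewrite !addnS.
Qed.


Lemma cup_cons f g x s :
  cup f g (x :: s) = f [::] * g (x :: s) + cup (fun t => f (x :: t)) g s.
Proof. by rewrite /cup big_ord_recl. Qed.

Lemma cup_nil f g : cup f g [::] = f [::] * g [::].
Proof. by rewrite /cup big_ord1. Qed.

Lemma cupDl f1 f2 g s :
  cup (fun t => f1 t + f2 t) g s = cup f1 g s + cup f2 g s.
Proof. by rewrite -big_split; apply: eq_bigr => i _; rewrite mulrDl. Qed.

Lemma cupDr f g1 g2 s :
  cup f (fun t => g1 t + g2 t) s = cup f g1 s + cup f g2 s.
Proof. by rewrite -big_split; apply: eq_bigr => i _; rewrite mulrDr. Qed.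

Lemma cupZl a f g s : cup (fun t => a * f t) g s = a * cup f g s.
Proof. by rewrite mulr_sumr; apply: eq_bigr => i _; rewrite mulrA. Qed.

Lemma eq_cup f f' g g' : f =1 f' -> g =1 g' -> cup f g =1 cup f' g'.
Proof. by move=> e1 e2 s; apply: eq_bigr => i _; rewrite e1 e2. Qed.

Lemma cupA f g h s : cup f (cup g h) s = cup (cup f g) h s.
Proof.
elim: s f => [|x s IH] f; first by rewrite !cup_nil mulrA.
rewrite cup_cons cup_cons IH [in RHS]cup_cons.
under [X in _ = _ + X]eq_cup do [rewrite cup_cons | over].
by rewrite cupDl cupZl cup_nil mulrDr mulrA !addrA.
Qed.

Lemma cup1l f s : cup cup1 f s = f s.
Proof.
case: s => [|x s]; first by rewrite cup_nil mul1r.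
by rewrite cup_cons mul1r [X in _ + X]big1 ?addr0 // => i _; rewrite mul0r.
Qed.

Lemma cup1r f s : cup f cup1 s = f s.
Proof.
elim: s f => [|x s IH] f; first by rewrite cup_nil mulr1.
by rewrite cup_cons mulr0 add0r IH.
Qed.

Lemma bar_diff_cup f g s :
  bar_diff (cup f g) s =
  cup (bar_diff f) g s + cup (gsign f) (bar_diff g) s.
Proof.
case: s => [|x s0]; first by rewrite !cup_nil mul0r mulr0 addr0.
have : size (x :: s0) = (size s0).+1 by [].
move: (x :: s0) (size s0) => s n sn {x s0}.
pose A k i := (-1) ^+ i * f (face i (take k s)) * g (drop k s).
pose B k i := (-1) ^+ (k + i) * f (take k s) * g (face i (drop k s)).
have dE h (t : seq G) : (0 < size t)%N -> bar_diff h t =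
    \sum_(i < (size t).+1) (-1) ^+ i * h (face i t) by case: t.
have L : bar_diff (cup f g) s = \sum_(i < n.+2) \sum_(j < n.+1)
    (if (i <= j)%N then A j.+1 i else B j (i - j)%N).
  rewrite dE ?sn //; apply: eq_bigr => i _; rewrite /cup size_face sn /=.
  rewrite mulr_sumr; apply: eq_bigr => j _; case: leqP => ij.
    by rewrite take_face ?drop_face ?sn // /A mulrA.
  have iS : (i <= size s)%N by rewrite sn; have := ltn_ord i; lia.
  rewrite take_face_gt ?drop_face_gt // /B mulrA subnKC //; lia.
have M : cup (bar_diff f) g s =
    \sum_(j < n.+1) ((\sum_(i < j.+1) A j.+1 i) + A j.+1 j.+1).
  rewrite /cup sn big_ord_recl /= take0 mul0r add0r.
  apply: eq_bigr => j _; rewrite /bump /= add1n.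
  have tj : size (take j.+1 s) = j.+1.
    by rewrite size_take_min sn; have := ltn_ord j; lia.
  by rewrite dE ?tj // mulr_suml big_ord_recr.
have N : cup (gsign f) (bar_diff g) s =
    \sum_(j < n.+1) (B j 0%N + \sum_(i < n.+1 - j) B j i.+1).
  rewrite /cup sn big_ord_recr /= -sn drop_size mulr0 addr0.
  apply: eq_bigr => j _; have jn := ltn_ord j.
  rewrite dE ?size_drop ?sn; last by lia.
  rewrite big_ord_recl mulrDr mulr_sumr /gsign size_takel ?sn ?(ltnW jn) //; congr (_ + _).
    by rewrite /B addn0 expr0 mul1r.
  apply: eq_bigr => i _; rewrite /B /bump /= exprD.
  rewrite -!mulrA; congr (_ * _); rewrite !mulrA; congr (_ * _).
  by rewrite -signr_odd; case: odd; rewrite ?expr1 ?expr0 ?mulr1 ?mul1r ?mulrN1 ?mulN1r.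
rewrite L M N -big_split exchange_big /=; apply: eq_bigr => j _.
have jn := ltn_ord j.
have -> : A j.+1 j.+1 = - B j 0%N.
  rewrite /A /B addn0 exprS mulN1r !mulNr; congr (- (_ * _ * _)).
    congr f; apply: (@eq_from_nth G 1%g) => [|k].
      by rewrite size_face !size_take_min sn; lia.
    rewrite size_face size_take_min sn => Hk.
    rewrite nth_face ?size_take_min ?sn; try lia.
    rewrite !nth_take; try lia.
    by rewrite ifT //; lia.
  congr g; rewrite [drop j s](drop_nth 1%g) ?sn //.
rewrite addrA addrNK.
rewrite -(big_mkord xpredT (fun i => if (i <= j)%N then A j.+1 i else B j (i - j)%N)).
rewrite (big_cat_nat (n := j.+1)) //=; last by lia.
congr (_ + _).
  by rewrite big_mkord; apply: eq_bigr => i _; rewrite ifT // -ltnS.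
rewrite -{1}[j.+1]add0n big_addn subSS big_mkord; apply: eq_bigr => i _.
rewrite ifF; last by lia.
by congr (B j _); lia.
Qed.

End BarFunctions.

Section DiscreteContinuity.
Variables (T : topologicalType) (R : nzRingType).
Implicit Types f g : T -> discrete_topology R.

Lemma continuous_discreteP f :
  continuous f <-> forall x, \forall y \near x, f y = f x.
Proof.
split=> [cf x|cf x A].
  by apply: (cf x [set y | y = f x]); rewrite nbhs_principalE.
by rewrite nbhs_principalE => /principal_filterP Afx; apply: filterS (cf x) => y fy; rewrite -[_ y]/(A (f y)) fy.
Qed.

Lemma continuous_discrete_op2 (op : R -> R -> R) f g :
  continuous f -> continuous g ->
  continuous (fun x => op (f x) (g x) : discrete_topology R).
Proof.
move=> /continuous_discreteP cf /continuous_discreteP cg.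
by apply/continuous_discreteP => x; apply: filterS2 (cf x) (cg x) => y /= fy gy; rewrite fy gy.
Qed.

Lemma continuous_discrete_sum n (F : 'I_n -> T -> discrete_topology R) :
  (forall i, continuous (F i)) ->
  continuous (fun x => \sum_(i < n) (F i x : R) : discrete_topology R).
Proof.
move=> cF; apply/continuous_discreteP => x.
have : \forall y \near x, forall i, F i y = F i x.
  by apply: filter_forall => i; have /continuous_discreteP/(_ x) := cF i.
by apply: filterS => y E; apply: eq_bigr => i _; rewrite E.
Qed.

End DiscreteContinuity.

Lemma continuous_ptws (T U : topologicalType) (I : Type) (f : T -> {ptws I -> U}) :
  (forall i, continuous (fun x => f x i)) -> continuous f.
Proof.
move=> cf x; apply/cvg_sup => i.
exact: (@continuous_comp_initial _ T U (fun h : I -> U => h i) f (cf i)).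
Qed.

Lemma nth_codom_ord (U : Type) (u : U) n (x : 'I_n -> U) j (jn : (j < n)%N) :
  nth u (codom x) j = x (Ordinal jn).
Proof.
rewrite /codom /image_mem (nth_map (Ordinal jn)) ?size_enum_ord //.
by congr x; apply: val_inj; rewrite /= nth_enum_ord.
Qed.

Lemma continuous_codom_nth (G : topologicalGroupType) n j :
  continuous (fun x : {ptws 'I_n -> G} => nth 1%g (codom x) j).
Proof.
have [jn|nj] := ltnP j n.
  rewrite (_ : (fun x => _) = fun x : {ptws 'I_n -> G} => x (Ordinal jn)).
    exact: (@proj_continuous 'I_n (fun=> G) (Ordinal jn)).
  by apply/funext => x; rewrite nth_codom_ord.
rewrite (_ : (fun x => _) = fun=> 1%g); first exact: cst_continuous.
by apply/funext => x; rewrite nth_default // size_codom card_ord.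
Qed.

Section Cochains.
Variables (G : topologicalGroupType) (R : nzRingType).

(* For each n, f restricted to words of length n is continuous on G^n with the *)
(* product topology and R discrete; f is supported on words of bounded length, *)
(* so that it is an element of the direct sum of the groups C^n(G; R).         *)
Definition continuous_cochain : set (seq G -> R) :=
  [set f | (forall n, continuous
      (fun x : {ptws 'I_n -> G} => f (codom x) : discrete_topology R)) /\
    exists N : nat, forall s, (N <= size s)%N -> f s = 0].

Definition cochain := set_type continuous_cochain.

HB.instance Definition _ := SubChoice.copy cochain
  {f : seq G -> R | f \in continuous_cochain}.

Lemma cochainP (c : cochain) : continuous_cochain (val c).
Proof. exact: set_mem (valP c). Qed.

Lemma cochain_inj (c c' : cochain) : val c =1 val c' -> c = c'.
Proof. by move=> e; apply: val_inj; apply/funext. Qed.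

Lemma cochain_zmod_closed : zmod_closed [in continuous_cochain].
Proof.
split=> [|f g /set_mem[cf [M fM]] /set_mem[cg [N gN]]]; apply/mem_set; split.
- by move=> n; apply: cst_continuous.
- by exists 0%N.
- by move=> n; exact: (continuous_discrete_op2 (op := fun a b : R => a - b) (cf n) (cg n)).
exists (maxn M N) => s; rewrite geq_max => /andP[sM sN].
by rewrite -[LHS]/(f s - g s) fM // gN // subrr.
Qed.

HB.instance Definition _ := GRing.SubChoice_isSubZmodule.Build (seq G -> R)
  [in continuous_cochain] cochain cochain_zmod_closed.

Lemma cochainB (c c' : cochain) s : val (c - c') s = val c s - val c' s.
Proof. by rewrite raddfB. Qed.

Lemma cochainD (c c' : cochain) s : val (c + c') s = val c s + val c' s.
Proof. by rewrite raddfD. Qed.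

Lemma cochain0 s : val (0 : cochain) s = 0.
Proof. by rewrite raddf0. Qed.

End Cochains.

Lemma continuous_cochain_comp (T : topologicalType) (G : topologicalGroupType)
    (R : nzRingType) (f : seq G -> R) m (h : T -> seq G) :
  continuous_cochain f -> (forall x, size (h x) = m) ->
  (forall j, (j < m)%N -> continuous (fun x => nth 1%g (h x) j)) ->
  continuous (fun x => f (h x) : discrete_topology R).
Proof.
move=> [cf _] sh ch.
pose h' (x : T) : {ptws 'I_m -> G} := fun j : 'I_m => nth 1%g (h x) j.
have hE x : h x = codom (h' x).
  apply: (@eq_from_nth _ 1%g); first by rewrite size_codom card_ord sh.
  by move=> j; rewrite sh => jm; rewrite nth_codom_ord.
rewrite (_ : (fun x => _) = (fun y : {ptws 'I_m -> G} => f (codom y)) \o h').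
  move=> x; apply: continuous_comp; last exact: cf.
  by apply: continuous_ptws => i; apply: ch.
by apply/funext => x; rewrite hE.
Qed.

Section CochainRing.
Variables (G : topologicalGroupType) (R : nzRingType).
Local Notation cochain := (cochain G R).
Implicit Types (f g : seq G -> R) (c : cochain).

Lemma continuous_face n i (Hi : (i <= n)%N) j : (j < n.-1)%N ->
  continuous (fun x : {ptws 'I_n -> G} => nth 1%g (face i (codom x)) j).
Proof.
move=> jn; rewrite (_ : (fun x => _) = fun x : {ptws 'I_n -> G} =>
    if (j.+1 < i)%N then nth 1%g (codom x) j
    else if j.+1 == i then (nth 1 (codom x) j * nth 1 (codom x) j.+1)%g
    else nth 1%g (codom x) j.+1); last first.
  by apply/funext => x; rewrite nth_face // size_codom card_ord.
case: (j.+1 < i)%N; first exact: continuous_codom_nth.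
case: (j.+1 == i); last exact: continuous_codom_nth.
by apply: continuous_mulg; exact: continuous_codom_nth.
Qed.

Lemma bar_diff_cochain f : continuous_cochain f -> continuous_cochain (bar_diff f).
Proof.
move=> Hf; split=> [[|n]|].
- rewrite (_ : (fun x => _) = fun=> 0); first exact: cst_continuous.
  by apply/funext => x; case: (codom x) (size_codom x) => //; rewrite card_ord.
- rewrite (_ : (fun x => _) = fun x : {ptws 'I_n.+1 -> G} =>
      \sum_(i < n.+2) (-1) ^+ i * f (face i (codom x))).
    apply: continuous_discrete_sum => i.
    apply: (continuous_discrete_op2 (op := fun a b : R => a * b)).
      exact: cst_continuous.
    apply: (continuous_cochain_comp (m := n)) => // [x|j jn].
      by rewrite size_face size_codom card_ord.
    have Hi : (i <= n.+1)%N by rewrite -ltnS.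
    exact: (continuous_face (n := n.+1) Hi jn).
  apply/funext => x.
  have : size (codom x) = n.+1 by rewrite size_codom card_ord.
  by case: (codom x) => //= y s [->].
have [N fN] := Hf.2; exists N.+1 => s; case: s => // y s sN.
by apply: big1 => i _; rewrite fN ?mulr0 // size_face.
Qed.

Lemma cup_cochain f g :
  continuous_cochain f -> continuous_cochain g -> continuous_cochain (cup f g).
Proof.
move=> Hf Hg; split=> [n|].
  rewrite (_ : (fun x => _) = fun x : {ptws 'I_n -> G} =>
      \sum_(i < n.+1) f (take i (codom x)) * g (drop i (codom x))).
    apply: continuous_discrete_sum => i.
    have iN : (i <= n)%N by rewrite -ltnS.
    apply: (continuous_discrete_op2 (op := fun a b : R => a * b)).
      apply: (continuous_cochain_comp (m := i)) => // [x|j ji].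
        by rewrite size_takel // size_codom card_ord.
      rewrite (_ : (fun x => _) = fun x : {ptws 'I_n -> G} => nth 1%g (codom x) j).
        exact: continuous_codom_nth.
      by apply/funext => x; rewrite nth_take.
    apply: (continuous_cochain_comp (m := n - i)) => // [x|j ji].
      by rewrite size_drop size_codom card_ord.
    rewrite (_ : (fun x => _) = fun x : {ptws 'I_n -> G} => nth 1%g (codom x) (i + j)).
      exact: continuous_codom_nth.
    by apply/funext => x; rewrite nth_drop.
  by apply/funext => x; rewrite /cup size_codom card_ord.
have [M fM] := Hf.2; have [N gN] := Hg.2.
exists (M + N)%N => s sMN; apply: big1 => i _.
have iN := ltn_ord i.
have [Mi|iM] := leqP M i; first by rewrite fM ?mul0r // size_takel.
by rewrite gN ?mulr0 // size_drop; lia.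
Qed.

Lemma cup1_cochain : continuous_cochain (cup1 R : seq G -> R).
Proof.
split=> [n|]; last by exists 1%N => -[].
rewrite (_ : (fun x => _) = fun=> (n == 0)%N%:R); first exact: cst_continuous.
by apply/funext => x; rewrite /cup1 -size_eq0 size_codom card_ord.
Qed.

Definition cochain_one : cochain := exist _ (cup1 R) (mem_set cup1_cochain).
Definition cochain_mul c c' : cochain :=
  exist _ (cup (val c) (val c')) (mem_set (cup_cochain (cochainP c) (cochainP c'))).
Definition coboundary c : cochain :=
  exist _ (bar_diff (val c)) (mem_set (bar_diff_cochain (cochainP c))).

Lemma cochain_mulA : associative cochain_mul.
Proof. by move=> a b c; apply: cochain_inj => s; apply: cupA. Qed.
Lemma cochain_mul1 : left_id cochain_one cochain_mul.
Proof. by move=> a; apply: cochain_inj => s; apply: cup1l. Qed.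
Lemma cochain_mulr1 : right_id cochain_one cochain_mul.
Proof. by move=> a; apply: cochain_inj => s; apply: cup1r. Qed.
Lemma cochain_mulDl : left_distributive cochain_mul +%R.
Proof.
move=> a b c; apply: cochain_inj => s; rewrite cochainD /=.
by rewrite -cupDl; apply: eq_cup => // t; rewrite cochainD.
Qed.
Lemma cochain_mulDr : right_distributive cochain_mul +%R.
Proof.
move=> a b c; apply: cochain_inj => s; rewrite cochainD /=.
by rewrite -cupDr; apply: eq_cup => // t; rewrite cochainD.
Qed.

HB.instance Definition _ := GRing.Zmodule_isPzRing.Build cochain
  cochain_mulA cochain_mul1 cochain_mulr1 cochain_mulDl cochain_mulDr.

Lemma val_coboundary c : val (coboundary c) = bar_diff (val c).
Proof. by []. Qed.

Lemma coboundaryB : {morph coboundary : c c' / c - c'}.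
Proof.
move=> c c'; apply: cochain_inj => -[|x s]; rewrite cochainB !val_coboundary.
  by rewrite subrr.
rewrite /bar_diff -sumrB; apply: eq_bigr => i _.
by rewrite cochainB mulrBr.
Qed.

HB.instance Definition _ := GRing.isZmodMorphism.Build cochain cochain
  coboundary coboundaryB.

Lemma coboundaryK c : coboundary (coboundary c) = 0.
Proof. by apply: cochain_inj => s; rewrite cochain0; apply: bar_diffK. Qed.

Lemma gsign_cochain f : continuous_cochain f -> continuous_cochain (gsign f).
Proof.
move=> [cf [N fN]]; split=> [n|]; last first.
  by exists N => s /fN fs; rewrite /gsign fs mulr0.
rewrite (_ : (fun x => _) = fun x : {ptws 'I_n -> G} => (-1) ^+ n * f (codom x)).
  apply: (continuous_discrete_op2 (op := fun a b : R => a * b) _ (cf n)).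
  exact: cst_continuous.
by apply/funext => x; rewrite /gsign size_codom card_ord.
Qed.

Definition cochain_sign c : cochain :=
  exist _ (gsign (val c)) (mem_set (gsign_cochain (cochainP c))).

Lemma val_cochain_sign c : val (cochain_sign c) = gsign (val c).
Proof. by []. Qed.

Lemma coboundaryM c c' :
  coboundary (c * c') = coboundary c * c' + cochain_sign c * coboundary c'.
Proof. by apply: cochain_inj => s; rewrite cochainD; apply: bar_diff_cup. Qed.

Lemma coboundary_sign c : coboundary (cochain_sign c) = - cochain_sign (coboundary c).
Proof.
apply: cochain_inj => s; rewrite -[- _]sub0r cochainB cochain0 sub0r.
rewrite val_cochain_sign !val_coboundary val_cochain_sign.
case: s => [|x s]; first by rewrite /gsign mulr0 oppr0.
rewrite /gsign /bar_diff mulr_sumr -sumrN; apply: eq_bigr => i _.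
rewrite size_face [size (x :: s)]/= exprS mulN1r mulNr opprK !mulrA -!exprD.
by rewrite addnC.
Qed.

Lemma coboundary1 : coboundary 1 = 0.
Proof.
have := coboundaryM 1 1; rewrite !mulr1.
have -> : cochain_sign 1 = 1.
  by apply: cochain_inj => -[|x s]; rewrite /= /gsign ?mul1r //= mulr0.
by rewrite mul1r => /(congr1 (fun c => c - coboundary 1)); rewrite addrK subrr.
Qed.

Definition is_cocycle : {pred cochain} := fun c => coboundary c == 0.

Definition cocycle := {c : cochain | is_cocycle c}.

HB.instance Definition _ := SubChoice.copy cocycle {c : cochain | is_cocycle c}.

Lemma is_cocycle_subring : subring_closed is_cocycle.
Proof.
split=> [|c c' /eqP dc /eqP dc'|c c' /eqP dc /eqP dc'].
- by apply/eqP; exact: coboundary1.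
- by apply/eqP; rewrite raddfB /= dc dc' subrr.
- by apply/eqP; rewrite coboundaryM dc dc' mul0r mulr0 addr0.
Qed.

HB.instance Definition _ := GRing.SubChoice_isSubPzRing.Build cochain
  is_cocycle cocycle is_cocycle_subring.

Lemma cocycleP (z : cocycle) : coboundary (val z) = 0.
Proof. exact/eqP/(valP z). Qed.

Definition coboundaries : {pred cocycle} :=
  fun z => `[< exists c, val z = coboundary c >].

Lemma coboundaries_zmod_closed : zmod_closed coboundaries.
Proof.
split=> [|z z' /asboolP[c zc] /asboolP[c' zc']]; apply/asboolP.
  by exists 0; rewrite !raddf0.
by exists (c - c'); rewrite !raddfB /= zc zc'.
Qed.

HB.instance Definition _ := GRing.isZmodClosed.Build cocycle coboundaries
  coboundaries_zmod_closed.

Lemma coboundariesMr (z b : cocycle) : b \in coboundaries -> b * z \in coboundaries.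
Proof.
move=> /asboolP[c bc]; apply/asboolP; exists (c * val z).
by rewrite coboundaryM cocycleP mulr0 addr0 rmorphM /= bc.
Qed.

Lemma coboundariesMl (z b : cocycle) : b \in coboundaries -> z * b \in coboundaries.
Proof.
move=> /asboolP[c bc]; apply/asboolP; exists (cochain_sign (val z) * c).
have ssK : cochain_sign (cochain_sign (val z)) = val z.
  apply: cochain_inj => s; rewrite /= /gsign mulrA -exprD addnn -mul2n.
  by rewrite exprM sqrrN !expr1n mul1r.
rewrite coboundaryM coboundary_sign cocycleP ssK rmorphM /= bc.
suff -> : cochain_sign 0 = 0 by rewrite oppr0 mul0r add0r.
by apply: cochain_inj => s; rewrite val_cochain_sign /gsign !cochain0 mulr0.
Qed.

(* The cohomology of the total complex of the direct sum of the C^n(G; R),     *)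
(* i.e. the direct sum over n of the H^n(G; R).                                *)
Definition continuous_cohomology := Quotient.quot coboundaries.
Local Notation Hc := continuous_cohomology.

HB.instance Definition _ := GRing.Zmodule.on Hc.
HB.instance Definition _ := EqQuotient.on Hc.

Definition class_of (z : cocycle) : Hc := \pi_Hc z.

Lemma class_of_eq (z z' : cocycle) :
  class_of z = class_of z' <-> z - z' \in coboundaries.
Proof. by rewrite Quotient.idealrBE; split=> [/eqP|/eqP]. Qed.

Lemma class_ofB : {morph class_of : z z' / z - z'}.
Proof. by move=> z z'; rewrite /class_of raddfB. Qed.

HB.instance Definition _ := GRing.isZmodMorphism.Build cocycle Hc
  class_of class_ofB.

Lemma class_of_surj (x : Hc) : exists z, x = class_of z.
Proof. by exists (repr x); rewrite /class_of reprK. Qed.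

Definition cohomology_mul (x y : Hc) : Hc := class_of (repr x * repr y).

Lemma class_ofM (z z' : cocycle) :
  class_of (z * z') = cohomology_mul (class_of z) (class_of z').
Proof.
apply/class_of_eq; set w := repr _; set w' := repr _.
have zw : z - w \in coboundaries by apply/class_of_eq; rewrite /class_of reprK.
have zw' : z' - w' \in coboundaries by apply/class_of_eq; rewrite /class_of reprK.
rewrite -[z * z'](addrNK (w * z')) -mulrBl -addrA -mulrBr.
by apply: rpredD; [apply: coboundariesMr|apply: coboundariesMl].
Qed.

Lemma cohomology_mulA : associative cohomology_mul.
Proof.
move=> x y z; have [[a ->] [b ->] [c ->]] :=
  And3 (class_of_surj x) (class_of_surj y) (class_of_surj z).
by rewrite -!class_ofM mulrA.
Qed.

Lemma cohomology_mul1 : left_id (class_of 1) cohomology_mul.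
Proof. by move=> x; have [a ->] := class_of_surj x; rewrite -class_ofM mul1r. Qed.

Lemma cohomology_mulr1 : right_id (class_of 1) cohomology_mul.
Proof. by move=> x; have [a ->] := class_of_surj x; rewrite -class_ofM mulr1. Qed.

Lemma cohomology_mulDl : left_distributive cohomology_mul +%R.
Proof.
move=> x y z; have [[a ->] [b ->] [c ->]] :=
  And3 (class_of_surj x) (class_of_surj y) (class_of_surj z).
by rewrite -raddfD -!class_ofM mulrDl raddfD.
Qed.

Lemma cohomology_mulDr : right_distributive cohomology_mul +%R.
Proof.
move=> x y z; have [[a ->] [b ->] [c ->]] :=
  And3 (class_of_surj x) (class_of_surj y) (class_of_surj z).
by rewrite -raddfD -!class_ofM mulrDr raddfD.
Qed.

HB.instance Definition _ := GRing.Zmodule_isPzRing.Build Hc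
  cohomology_mulA cohomology_mul1 cohomology_mulr1
  cohomology_mulDl cohomology_mulDr.

HB.instance Definition _ := GRing.isMonoidMorphism.Build cocycle Hc
  class_of (conj erefl class_ofM).

End CochainRing.

Section Pullback.
Variables (G H : topologicalGroupType) (R : nzRingType).
Variable phi : continuousHomType G H.

Lemma face_map i (s : seq G) : face i (map phi s) = map phi (face i s).
Proof.
elim: s i => [|x [|y s] IH] [|[|i]] //=; first by rewrite gmulfM.
by congr (_ :: _); apply: (IH i.+1).
Qed.

Lemma pullback_cochain (f : seq H -> R) :
  continuous_cochain f -> continuous_cochain (f \o map phi).
Proof.
move=> Hf; split=> [n|]; last first.
  by have [N fN] := Hf.2; exists N => s sN; rewrite /= fN // size_map.
apply: (continuous_cochain_comp (m := n)
    (h := fun x : {ptws 'I_n -> G} => map phi (codom x)) Hf) => [x|j jn].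
  by rewrite size_map size_codom card_ord.
rewrite (_ : (fun x => _) =
    phi \o (fun x : {ptws 'I_n -> G} => nth 1%g (codom x) j)).
  move=> x; apply: continuous_comp; first exact: continuous_codom_nth.
  exact: cts_fun.
by apply/funext => x; rewrite /= (nth_map 1%g) // size_codom card_ord.
Qed.

Definition cochain_pullback (c : cochain H R) : cochain G R :=
  exist _ (val c \o map phi) (mem_set (pullback_cochain (cochainP c))).

Lemma cochain_pullbackB : {morph cochain_pullback : c c' / c - c'}.
Proof. by move=> c c'; apply: cochain_inj => s; rewrite cochainB; exact: cochainB. Qed.

Lemma cochain_pullback1 : cochain_pullback 1 = 1.
Proof. by apply: cochain_inj => -[]. Qed.

Lemma cochain_pullbackM : {morph cochain_pullback : c c' / c * c'}.
Proof.
move=> c c'; apply: cochain_inj => s.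
rewrite /= /cup size_map; apply: eq_bigr => i _ /=.
by rewrite map_take map_drop.
Qed.

HB.instance Definition _ := GRing.isZmodMorphism.Build (cochain H R)
  (cochain G R) cochain_pullback cochain_pullbackB.
HB.instance Definition _ := GRing.isMonoidMorphism.Build (cochain H R)
  (cochain G R) cochain_pullback (conj cochain_pullback1 cochain_pullbackM).

Lemma coboundary_pullback (c : cochain H R) :
  coboundary (cochain_pullback c) = cochain_pullback (coboundary c).
Proof.
apply: cochain_inj => -[|x s] //.
have E (h : seq H -> R) : bar_diff (h \o map phi) (x :: s) =
    bar_diff h (map phi (x :: s)).
  rewrite /bar_diff [map phi (x :: s)]/= -[phi x :: _]/(map phi (x :: s)).
  by rewrite size_map; apply: eq_bigr => i _; rewrite face_map.
exact: E.
Qed.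

Lemma pullback_cocycle (z : cocycle H R) : is_cocycle (cochain_pullback (val z)).
Proof. by apply/eqP; rewrite coboundary_pullback cocycleP raddf0. Qed.

Definition cocycle_pullback (z : cocycle H R) : cocycle G R :=
  exist _ (cochain_pullback (val z)) (pullback_cocycle z).

Definition pullback (x : continuous_cohomology H R) : continuous_cohomology G R :=
  class_of (cocycle_pullback (repr x)).

Lemma pullback_class (z : cocycle H R) :
  pullback (class_of z) = class_of (cocycle_pullback z).
Proof.
rewrite /pullback; set w := repr _; apply/class_of_eq.
have : w - z \in @coboundaries H R by apply/class_of_eq; rewrite /class_of reprK.
move=> /asboolP[c wz]; apply/asboolP; exists (cochain_pullback c).
by rewrite coboundary_pullback -wz !raddfB.
Qed.

Lemma pullbackB : {morph pullback : x y / x - y}.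
Proof.
move=> x y; have [[a ->] [b ->]] := conj (class_of_surj x) (class_of_surj y).
rewrite -raddfB !pullback_class -raddfB; congr class_of.
by apply: val_inj; rewrite /= !raddfB.
Qed.

Lemma pullback_monoid_morphism : monoid_morphism pullback.
Proof.
split=> [|x y].
  rewrite [LHS]pullback_class; congr class_of.
  by apply: val_inj; rewrite /= rmorph1.
have [[a ->] [b ->]] := conj (class_of_surj x) (class_of_surj y).
rewrite -rmorphM !pullback_class -rmorphM; congr class_of.
by apply: val_inj; rewrite /= !rmorphM.
Qed.

HB.instance Definition _ := GRing.isZmodMorphism.Build
  (continuous_cohomology H R) (continuous_cohomology G R) pullback pullbackB.
HB.instance Definition _ := GRing.isMonoidMorphism.Build
  (continuous_cohomology H R) (continuous_cohomology G R) pullback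
  pullback_monoid_morphism.

End Pullback.

Section Fusion.
Variable G : topologicalGroupType.
Implicit Types P Q S : closedSubgroup G.

Definition conjugates_into (g : G) (P Q : set G) : Prop :=
  forall x : G, P x -> Q (g * x * g^-1)%g.

Definition conj_hom g P Q (gPQ : conjugates_into g P Q) (x : P) : Q :=
  exist _ (g * \val x * g^-1)%g (mem_set (gPQ _ (set_mem (valP x)))).

Definition incl_hom P Q (PQ : P `<=` Q) (x : P) : Q :=
  exist _ (\val x) (mem_set (PQ _ (set_mem (valP x)))).

Section Hom.
Variables (g : G) (P Q : closedSubgroup G).
Variables (gPQ : conjugates_into g P Q) (PQ : P `<=` Q).

Lemma conj_hom_continuous : continuous (conj_hom gPQ).
Proof.
apply: continuous_subgroup.
apply: continuous_mulg; last exact: cst_continuous.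
apply: continuous_mulg; first exact: cst_continuous.
exact: subgroup_val_continuous.
Qed.

Lemma conj_homM : {morph conj_hom gPQ : x y / (x * y)%g}.
Proof.
move=> x y; apply: val_inj; rewrite [RHS]gmulfM.
rewrite -[LHS]/(g * \val (x * y) * g^-1)%g gmulfM /=.
by rewrite !mulgA -[(_ * g^-1 * g)%g]mulgA mulVg mulg1.
Qed.

HB.instance Definition _ := @isContinuous.Build P Q (conj_hom gPQ)
  conj_hom_continuous.
HB.instance Definition _ := isMultiplicative.Build P Q (conj_hom gPQ) conj_homM.

Lemma incl_hom_continuous : continuous (incl_hom PQ).
Proof. by apply: continuous_subgroup; exact: subgroup_val_continuous. Qed.

Lemma incl_homM : {morph incl_hom PQ : x y / (x * y)%g}.
Proof. by move=> x y; apply: val_inj; rewrite [RHS]gmulfM; apply: gmulfM. Qed.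

HB.instance Definition _ := @isContinuous.Build P Q (incl_hom PQ)
  incl_hom_continuous.
HB.instance Definition _ := isMultiplicative.Build P Q (incl_hom PQ) incl_homM.

End Hom.

End Fusion.

(* A category whose objects are closed subgroups of G and whose morphisms are  *)
(* continuous homomorphisms is given by its sets of morphisms.                 *)
Definition hom_system (G : topologicalGroupType) :=
  forall P Q : closedSubgroup G, set (continuousHomType P Q).

(* Every c_g is continuous (conj_hom_continuous), so bundling continuity in    *)
(* the morphisms of F_S(G) excludes nothing.                                   *)
Definition fusion_system (G : topologicalGroupType) (S : closedSubgroup G) :
    hom_system G :=
  fun P Q => [set phi : continuousHomType P Q | [/\ P `<=` S, Q `<=` S &
    exists (g : G) (gPQ : conjugates_into g P Q),
      phi =1 conj_hom gPQ]].

Section StableElements.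
Variables (G : topologicalGroupType) (S : closedSubgroup G) (F : hom_system G).
Variable R : nzRingType.

Definition is_stable : set (continuous_cohomology S R) :=
  [set x | forall (P : closedSubgroup G) (PS : P `<=` S)
      (phi : continuousHomType P S), F phi ->
    pullback phi x = pullback (incl_hom PS) x].

Definition stable_cohomology := set_type is_stable.

HB.instance Definition _ := SubChoice.copy stable_cohomology
  {x : continuous_cohomology S R | x \in is_stable}.

Lemma is_stable_subring : subring_closed [in is_stable].
Proof.
split=> [|x y|x y].
- by apply/mem_set => P PS phi Fphi; rewrite !rmorph1.
- move=> /set_mem Sx /set_mem Sy; apply/mem_set => P PS phi Fphi.
  by rewrite !rmorphB /= (Sx P PS phi Fphi) (Sy P PS phi Fphi).
- move=> /set_mem Sx /set_mem Sy; apply/mem_set => P PS phi Fphi.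
  by rewrite !rmorphM /= (Sx P PS phi Fphi) (Sy P PS phi Fphi).
Qed.

HB.instance Definition _ := GRing.SubChoice_isSubPzRing.Build
  (continuous_cohomology S R) [in is_stable] stable_cohomology is_stable_subring.

End StableElements.

(* Main.v *)
From HB Require Import structures.
Require Import Defs.
From mathcomp Require Import all_boot all_order all_algebra.
From mathcomp Require Import all_classical topology.
From mathcomp Require Import ring zify.

(** Conjugation by an element of [G] is homotopic to the identity on cochains of
    [G], so restriction from [G] to [S] lands in the stable elements.  What
    remains is that it is injective, and onto the stable elements.

    The cohomology of every closed subgroup [P] is computed by homogeneous
    cochains on the whole of [G]: functions of words [a_0, ..., a_n] in [G] that
    are locally constant ([smooth]: they only see the cosets of the letters
    modulo some open normal subgroup) and invariant under left multiplication
    of all letters by [P] ([linvariant P]).  By [cocycle_extend] and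
    [restriction_exact], sending [f] to
    [[s_1; ...; s_n] |-> f [1; s_1; s_1 s_2; ...]] identifies the cohomology of
    this complex with that of [P].  The gain over inhomogeneous cochains is that
    the complexes of all subgroups live in one place: [G] acts on it by
    translation, the inclusions are inclusions of sets, and a cochain invariant
    under [S] is already invariant under an open subgroup [U = S N]
    ([linvariant_thicken]).

    The index [n] of [U] is prime to [p].  Summing the translates of a
    [U]-invariant cochain over [G / U] ([transfer]) gives a [G]-invariant one,
    and multiplies [G]-invariant cochains by [n].

    Injectivity ([res_ker]): if a [G]-invariant [f] is the differential of an
    [S]-invariant [h], then [f] is the differential of [n^-1 transfer h].

    Surjectivity ([res_stable_surj]): stability of the class of [f] means that for
    each [g] the cochain [f (g^-1 _) - f] is the differential of a cochain
    invariant under the intersection of [S] and [g S g^-1] ([stable_homotopy]).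
    By compactness of [G] one open [U = S N] works in place of [S] for all [g]
    at once ([uniform_homotopy]).  If these cochains are chosen
    compatibly along each double coset [U g U], their sum over [G / U] is a
    [U]-invariant cochain with differential [transfer f - n f]
    ([transfer_homotopy]); this takes the place of the double coset formula.  So
    the class of [f] is the restriction of that of [n^-1 transfer f]. *)

Set Implicit Arguments.
Unset Strict Implicit.
Unset Printing Implicit Defensive.

Import GRing.Theory.

Local Open Scope classical_set_scope.
Local Open Scope ring_scope.

(** * Zero-dimensionality of compact totally disconnected spaces *)

(** Compactness for properties that hold for all small enough members of a
    downward directed family [D]: if near each point of [K] they hold below some
    member, then one member serves all of [K]. *)
Lemma compact_eventually (X : topologicalType) (Y : Type) (D : set (set Y))
    (K : set X) (P : set Y -> X -> Prop) :
  compact K -> D !=set0 ->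
  (forall A B, D A -> D B -> exists2 C, D C & C `<=` A `&` B) ->
  (forall x, K x -> exists2 A, D A &
     \forall y \near x, forall B, D B -> B `<=` A -> P B y) ->
  exists2 A, D A & forall x, K x -> P A x.
Proof.
move=> /compact_near_coveringP cK [A0 DA0] DI PD.
pose F := filter_from D (fun A => [set B | D B /\ B `<=` A]).
have FF : Filter F.
  apply: filter_from_filter; first by exists A0.
  move=> A B DA DB; have [C DC CAB] := DI _ _ DA DB.
  exists C => // E [DE EC].
  by split; split=> // y /EC/CAB[].
have [|A DA /(_ A)] := cK _ F P FF.
  move=> x /PD[A DA nA].
  exists ([set y | forall B, D B -> B `<=` A -> P B y], [set B | D B /\ B `<=` A]).
    by split=> //=; exists A.
  by case=> y B /= [yA [DB BA]]; apply: yA.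
by move=> AP; exists A => //; apply: AP; split.
Qed.

(** In a compact Hausdorff space the intersection [Q] of the clopen sets
    containing [x] is connected.  If [Q] were split into two closed parts,
    normality would give an open [O] around the part containing [x] whose closure
    misses the other part.  The boundary of [O] is compact and disjoint from [Q],
    hence disjoint from some clopen [C] containing [x]; then [C `&` O] is clopen,
    so it contains [Q], although it misses the second part. *)
Lemma compact_zero_dimensional (T : topologicalType) :
  compact [set: T] -> hausdorff_space T -> totally_disconnected [set: T] ->
  zero_dimensional T.
Proof.
move=> cT hT tdT x y /eqP xy; apply: contrapT => nC.
pose Q := [set z : T | forall C, clopen C -> C x -> C z].
have Qy : Q y by move=> C Cc Cx; apply: contrapT => Cy; apply: nC; exists C.
suff cQ : connected Q.
  apply: xy; have <- : [set x] y = (x = y) by apply/propext; split=> ->.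
  by rewrite -(tdT x I); exists Q => //; split.
have clQ : closed Q.
  have -> : Q = \bigcap_(C in [set C : set T | clopen C /\ C x]) C.
    by apply/seteqP; split=> [z Qz C [Cc Cx]|z Qz C Cc Cx]; exact: Qz.
  by apply: closed_bigI => C [[]].
apply/connectedP => E [E0 QE sE].
wlog Ex : E E0 QE sE / E false x.
  move=> wl; have : Q x by [].
  rewrite QE => -[] Ex; first exact: (wl E).
  apply: (wl (E \o negb)) => // [b||]; first exact: E0.
    by rewrite QE setUC.
  by rewrite separatedC.
have EQ b : E b `<=` Q by rewrite QE; case: b => z Ez; [right|left].
have clE b : closed (E b).
  rewrite closure_id eqEsubset; split; first exact: subset_closure.
  move=> z Ez; have : Q z.
    by move: (closureS (@EQ b)); rewrite -((closure_id Q).1 clQ); apply.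
  rewrite QE; case: b Ez => Ez [] // Ez'; exfalso.
    by have : (E false `&` closure (E true)) z by []; rewrite sE.2.
  by have : (closure (E false) `&` E true) z by []; rewrite sE.1.
have [D /set_nbhsP[O [oO EO OD]] clD] : filter_from (set_nbhs (E false)) closure (~` E true).
  apply: (compact_normal hT cT (clE false)).
  apply/set_nbhsP; exists (~` E true); split=> //; first exact: closed_openC.
  move=> z Ez Ez'.
  by have : (E false `&` E true) z by []; rewrite (separated_disjoint sE).
have [C [Cc Cx] CK] : exists2 C, clopen C /\ C x &
    forall z, (closure O `\` O) z -> ~ C z.
  apply: (@compact_eventually _ _ [set C | clopen C /\ C x]).
  - apply: (subclosed_compact _ cT) => //.
    by apply: closedI; [exact: closed_closure|exact: open_closedC].
  - by exists setT; split=> //; exact: clopenT.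
  - by move=> A B [Ac Ax] [Bc Bx]; exists (A `&` B) => //; split=> //; exact: clopenI.
  move=> z [clOz nOz].
  have nQz : ~ Q z.
    rewrite QE => -[/EO//|Ez].
    by apply: clD Ez; exact: (closureS OD).
  have [C [Cc Cx nCz]] : exists C, [/\ clopen C, C x & ~ C z].
    by apply: contrapT => H; apply: nQz => C Cc Cx; apply: contrapT => ?; apply: H; exists C.
  exists C => //; have : nbhs z (~` C).
    by apply: open_nbhs_nbhs; split=> //; apply: closed_openC; case: Cc.
  by apply: filterS => w nCw B _ BC /BC.
have CO : clopen (C `&` O).
  split; first by apply: openI => //; case: Cc.
  have -> : C `&` O = C `&` closure O.
    apply/seteqP; split=> z [Cz Oz]; split=> //; first exact: subset_closure.
    by apply: contrapT => nOz; apply: (CK z).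
  by apply: closedI; [case: Cc|exact: closed_closure].
have [z Ez] := E0 true.
have [_ Oz] : (C `&` O) z by apply: (EQ true) => //; split=> //; exact: EO.
by apply: clD Ez; apply: subset_closure; exact: OD.
Qed.

(** * Open normal subgroups of profinite groups *)

Section Cosets.
Variable G : topologicalGroupType.
Implicit Types (N U V : set G) (x y : G).

Lemma subgroup1 U : subgroup U -> U 1%g.
Proof. by case=> /set_mem. Qed.

Lemma subgroupM U x y : subgroup U -> U x -> U y -> U (x * y)%g.
Proof. by move=> /group_closedM gU Ux Uy; apply/set_mem/gU; apply/mem_set. Qed.

Lemma subgroupV U x : subgroup U -> U x -> U (x^-1)%g.
Proof. by move=> /group_closedV gU Ux; apply/set_mem/gU; apply/mem_set. Qed.

Lemma subgroupP U : U 1%g -> (forall x y, U x -> U y -> U (x * y)%g) ->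
  (forall x, U x -> U (x^-1)%g) -> subgroup U.
Proof.
move=> U1 UM UV; split=> [|x y /set_mem Ux /set_mem Uy]; apply/mem_set => //.
by apply: UM => //; apply: UV.
Qed.

Lemma subgroupI U V : subgroup U -> subgroup V -> subgroup (U `&` V).
Proof.
move=> gU gV; apply: subgroupP.
- by split; exact: subgroup1.
- by move=> x y [Ux Vx] [Uy Vy]; split; exact: subgroupM.
- by move=> x [Ux Vx]; split; exact: subgroupV.
Qed.

Definition open_normal N := open N /\ normal_subgroup N.

Lemma open_normal_subgroup N : open_normal N -> subgroup N.
Proof. by case=> _ []. Qed.
Local Hint Resolve open_normal_subgroup : core.

Lemma open_normalJ N g x : open_normal N -> N x -> N (g^-1 * x * g)%g.
Proof. by case=> _ [_ nN] /(nN (g^-1)%g); rewrite invgK. Qed.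

Lemma open_normalT : open_normal [set: G].
Proof. by split; [exact: openT|split=> //; exact: subgroupP]. Qed.

Lemma open_normalI N M : open_normal N -> open_normal M -> open_normal (N `&` M).
Proof.
move=> [oN [gN nN]] [oM [gM nM]]; split; first exact: openI.
split=> [|g u [Nu Mu]]; first exact: subgroupI.
by split; [exact: nN|exact: nM].
Qed.

Definition coset N x : set G := [set y | N (x^-1 * y)%g].

Lemma coset_eqP N x y : subgroup N -> coset N x = coset N y <-> N (x^-1 * y)%g.
Proof.
move=> gN; split=> [E|Nxy].
  by rewrite -[N _]/(coset N x y) E /coset /= mulVg; exact: subgroup1.
apply/seteqP; split=> z; rewrite /coset /= => Nz.
  have -> : (y^-1 * z = (x^-1 * y)^-1 * (x^-1 * z))%g.
    by rewrite invgM invgK -!mulgA mulVKg.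
  by apply: subgroupM => //; exact: subgroupV.
have -> : (x^-1 * z = (x^-1 * y) * (y^-1 * z))%g by rewrite -!mulgA mulVKg.
exact: subgroupM.
Qed.

Lemma coset_sub N M x y : subgroup N -> subgroup M -> N `<=` M ->
  coset N x = coset N y -> coset M x = coset M y.
Proof. by move=> gN gM NM /(coset_eqP _ _ gN)/NM/(coset_eqP _ _ gM). Qed.

Lemma cosetMl N g x y : subgroup N -> coset N x = coset N y ->
  coset N (g * x)%g = coset N (g * y)%g.
Proof.
move=> gN /(coset_eqP _ _ gN) Nxy; apply/coset_eqP => //.
by rewrite invgM -mulgA mulKg.
Qed.

Lemma cosetM N x x' y y' : open_normal N ->
  coset N x = coset N x' -> coset N y = coset N y' ->
  coset N (x * y)%g = coset N (x' * y')%g.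
Proof.
move=> nN /(coset_eqP _ _ (open_normal_subgroup nN)) Nx Ey.
rewrite -[RHS](cosetMl x' (open_normal_subgroup nN) Ey).
apply/coset_eqP; first exact: open_normal_subgroup.
have -> : ((x * y)^-1 * (x' * y) = y^-1 * (x^-1 * x') * y)%g.
  by rewrite invgM !mulgA.
exact: open_normalJ.
Qed.

Lemma cosetV N x y : open_normal N -> coset N x = coset N y ->
  coset N (x^-1)%g = coset N (y^-1)%g.
Proof.
move=> nN /(coset_eqP _ _ (open_normal_subgroup nN)) Nxy.
apply/coset_eqP; first exact: open_normal_subgroup.
rewrite invgK; have := open_normalJ (x^-1)%g nN (subgroupV (open_normal_subgroup nN) Nxy).
by rewrite invgK invgM invgK !mulgA mulgK.
Qed.

Lemma mulg_continuousl g : continuous (fun x : G => g * x)%g.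
Proof.
by apply: continuous_mulg; [exact: cst_continuous|move=> x; exact: cvg_id].
Qed.

Lemma nbhs_mulgl x U : nbhs (1%g : G) U -> nbhs x [set y | U (x^-1 * y)%g].
Proof.
have := @mulg_continuousl (x^-1)%g x; rewrite /continuous_at mulVg.
by move=> cx nU; apply: cx.
Qed.

Lemma coset_nbhs N x : open_normal N -> nbhs x (coset N x).
Proof.
move=> nN; have [oN _] := nN; apply: (@nbhs_mulgl x N).
apply: open_nbhs_nbhs; split=> //; exact: (subgroup1 (open_normal_subgroup nN)).
Qed.

Lemma open_subgroup U : subgroup U -> nbhs (1%g : G) U -> open U.
Proof.
move=> gU nU; rewrite openE => x Ux.
apply: filterS (nbhs_mulgl x nU) => y Uy.
rewrite -[y](mulVKg x); apply: subgroupM => //.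
Qed.

End Cosets.
#[local] Hint Resolve open_normal_subgroup : core.

Section Profinite.
Variable G : topologicalGroupType.
Hypothesis profG : profinite G.
Let cG : compact [set: G]. Proof. by case: profG. Qed.

(** Inside a clopen neighbourhood [C] of 1, the elements [h] that can be inserted
    anywhere in a product without changing its membership in [C] form a normal
    subgroup; it is open because [G * G] is compact. *)
Lemma open_normal_base (V : set G) : nbhs (1%g : G) V ->
  exists2 N, open_normal N & N `<=` V.
Proof.
move=> nV.
have [C [C1 [oC cC]] CV] : filter_from [set D : set G | D 1%g /\ clopen D] id V.
  have [_ hG tG] := profG.
  exact: (zero_dimensional_cvg hG (compact_zero_dimensional cG hG tG) cG).
pose N := [set h | forall x y, C (x * y)%g <-> C (x * h * y)%g].
have nN : normal_subgroup N.
  split.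
    apply: subgroupP => [x y|h k Nh Nk x y|h Nh x y]; first by rewrite mulg1.
      by rewrite mulgA (Nh x y); exact: (Nk (x * h)%g y).
    by rewrite (Nh (x * h^-1)%g y) -[(x * h^-1 * h)%g]mulgA mulVg mulg1.
  move=> g h Nh x y; have := Nh (x * g)%g (g^-1 * y)%g.
  by rewrite -!mulgA mulVKg.
have NC : N `<=` C by move=> h /(_ 1 1)%g; rewrite !mulg1 mul1g; case=> + _; apply.
have [A nA PA] : exists2 A, nbhs (1%g : G) A & forall p : G * G, setT p ->
    forall h, A h -> C (p.1 * p.2)%g <-> C (p.1 * h * p.2)%g.
  apply: (@compact_eventually _ _ (nbhs (1%g : G)) [set: G * G]
    (fun A p => forall h, A h -> C (p.1 * p.2)%g <-> C (p.1 * h * p.2)%g)).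
  - by rewrite -setXTT; exact: compact_setX.
  - by exists setT; exact: filterT.
  - by move=> A B nA nB; exists (A `&` B) => //; exact: filterI.
  move=> p _.
  have cf : continuous (fun t : (G * G) * G => t.1.1 * t.2 * t.1.2)%g.
    apply: continuous_mulg; first apply: continuous_mulg.
    - by move=> t; apply: continuous_comp; exact: cvg_fst.
    - by move=> t; exact: cvg_snd.
    - by move=> t; apply: continuous_comp; [exact: cvg_fst|exact: cvg_snd].
  have [[B A] /= [nB nA] BA] : nbhs (p, 1%g : G)
      [set t | C (p.1 * p.2)%g <-> C (t.1.1 * t.2 * t.1.2)%g].
    apply: (cf (p, 1%g) [set z | C (p.1 * p.2)%g <-> C z]); rewrite /= mulg1.
    have [Cp|nCp] := pselect (C (p.1 * p.2)%g).
      by apply: (@filterS _ _ _ C) => //; exact: open_nbhs_nbhs.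
    apply: (@filterS _ _ _ (~` C)) => [z nCz|]; first by split.
    by apply: open_nbhs_nbhs; split=> //; exact: closed_openC.
  exists A => //; apply: filterS nB => q Bq A' nA' A'A h A'h.
  have BqA k : A k -> C (p.1 * p.2)%g <-> C (q.1 * k * q.2)%g.
    by move=> Ak; exact: (BA (q, k)).
  rewrite -(BqA h (A'A _ A'h)) (BqA 1%g) ?mulg1 //; exact: nbhs_singleton.
exists N; last exact: subset_trans CV.
split=> //; apply: open_subgroup; first by case: nN.
by apply: filterS nA => h Ah x y; apply: (PA (x, y)).
Qed.

End Profinite.

(** * Simplicial cochains on words *)

Section SimplicialCochains.
Variable R : comNzRingType.

(** The alternating sum of the omissions of one letter, written as a recursion on
    the word.  Words of length [n + 1] carry the homogeneous cochains of degree
    [n]; the complex is augmented by the value at the empty word. *)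
Fixpoint hdiff (T : Type) (f : seq T -> R) (s : seq T) : R :=
  if s is x :: t then f t - hdiff (fun u => f (x :: u)) t else 0.

(** The prism operator: the alternating sum over [i] of
    [f [a_0; ...; a_i; q a_i; ...; q a_n]]. *)
Fixpoint prism (T : Type) (q : T -> T) (f : seq T -> R) (s : seq T) : R :=
  if s is x :: t then f (x :: map q (x :: t)) - prism q (fun u => f (x :: u)) t
  else 0.

Lemma hdiff_map (T T' : Type) (h : T -> T') (f : seq T' -> R) s :
  hdiff (fun u => f (map h u)) s = hdiff f (map h s).
Proof. by elim: s f => //= x t IH f; rewrite (IH (fun u => f (h x :: u))). Qed.

Section Types.
Variable T : Type.
Implicit Types (f g : seq T -> R) (s t : seq T).

Lemma eq_hdiff f g : f =1 g -> hdiff f =1 hdiff g.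
Proof.
by move=> fg s; elim: s f g fg => //= x t IH f g fg; rewrite fg (IH _ (fun u => g (x :: u))).
Qed.

Lemma hdiffB f g s : hdiff (fun u => f u - g u) s = hdiff f s - hdiff g s.
Proof.
elim: s f g => [|x t IH] f g /=; first by rewrite subrr.
rewrite (IH (fun u => f (x :: u))); ring.
Qed.

Lemma hdiffZ a f s : hdiff (fun u => a * f u) s = a * hdiff f s.
Proof.
elim: s f => [|x t IH] f /=; first by rewrite mulr0.
by rewrite (IH (fun u => f (x :: u))) mulrBr.
Qed.

Lemma hdiff_sum (I : finType) (F : I -> seq T -> R) s :
  hdiff (fun u => \sum_i F i u) s = \sum_i hdiff (F i) s.
Proof.
elim: s F => [|x t IH] F /=; first by rewrite big1.
by rewrite sumrB (IH (fun i u => F i (x :: u))).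
Qed.

(** Any self-map [q] of the letters, equivariant or not, acts on simplicial
    cochains homotopically to the identity.  This single homotopy gives both the
    invariance under the choice of a retraction onto a subgroup and the triviality
    of conjugation. *)
Lemma hdiff_prism (q : T -> T) f s :
  hdiff (prism q f) s + prism q (hdiff f) s = f (map q s) - f s.
Proof.
elim: s f => [|x t IH] f /=; first by rewrite subrr addr0.
pose fx u := f (x :: u).
have prismB g h u : prism q (fun v => g v - h v) u = prism q g u - prism q h u.
  elim: u g h => [|y u IHu] g h /=; first by rewrite subrr.
  rewrite (IHu (fun v => g (y :: v))).
  ring.
rewrite (hdiffB (fun u => f (x :: q x :: map q u)) (prism q fx)).
rewrite (hdiff_map q (fun u => f (x :: q x :: u))).
rewrite (prismB f (hdiff fx)).
rewrite -[f (q x :: map q t)](subrK (f (x :: map q t))).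
have -> : f (x :: map q t) = f (x :: t) + (hdiff (prism q fx) t + prism q (hdiff fx) t).
  by rewrite IH addrC subrK.
rewrite -/fx; ring.
Qed.

Lemma prism0 (q : T -> T) f s : f =1 (fun=> 0) -> prism q f s = 0.
Proof.
by elim: s f => //= x t IH f f0; rewrite f0 (IH (fun u => f (x :: u))) ?subrr.
Qed.

End Types.

End SimplicialCochains.

(** * Homogeneous and inhomogeneous words *)

Section PartialProducts.
Variables (R : comNzRingType) (T : groupType).
Implicit Types (f : seq T -> R) (a b x : T) (s t : seq T).

Definition pprods a s := a :: scanl (fun x y => (x * y)%g) a s.

Lemma pprods_cons a x s : pprods a (x :: s) = a :: pprods (a * x)%g s.
Proof. by []. Qed.

Lemma map_pprods a x s : map (fun y => a * y)%g (pprods x s) = pprods (a * x)%g s.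
Proof. 
elim: s x => // y s IH x.
by rewrite !pprods_cons map_cons IH mulgA.
Qed.

Definition quotients s : seq T :=
  if s is x :: t then pairmap (fun y z => (y^-1 * z)%g) x t else [::].

Lemma pprodsK a s : quotients (pprods a s) = s.
Proof. by elim: s a => //= x s IH a; rewrite mulKg; congr cons; apply: IH. Qed.

Lemma quotientsK a s : pprods a (quotients (a :: s)) = a :: s.
Proof. by elim: s a => //= x s IH a; rewrite pprods_cons mulVKg IH. Qed.

(** Omitting the letter [i + 1] from the partial products of a word multiplies two
    of its neighbouring letters, which is an inhomogeneous face.  The omission of
    the first letter only becomes a face after a left translation, and is kept
    apart. *)
Lemma hdiff_pprods f b x t :
  hdiff f (pprods b (x :: t)) = f (pprods (b * x)%g t) +
    \sum_(i < (size t).+1) (-1) ^+ i.+1 * f (pprods b (face i.+1 (x :: t))).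
Proof.
elim: t f b x => [|y t IH] f b x.
  by rewrite big_ord1 /= subr0 expr1 mulN1r.
rewrite big_ord_recl pprods_cons.
rewrite -[LHS]/(f (pprods (b * x)%g (y :: t)) - hdiff (fun u => f (b :: u)) (pprods (b * x)%g (y :: t))).
rewrite IH opprD; congr (_ + (_ + _)).
  by rewrite /= expr1 mulN1r pprods_cons mulgA.
rewrite -sumrN; apply: eq_bigr => i _.
by rewrite [in RHS]exprS mulN1r mulNr.
Qed.

Lemma bar_diff_pprods f s : f [::] = 0 ->
  (forall x t, x \in s -> f (pprods x t) = f (pprods 1%g t)) ->
  bar_diff (fun t => f (pprods 1%g t)) s = hdiff f (pprods 1%g s).
Proof.
case: s => [f0 _|x t f0 Hf]; first by rewrite /= f0 subr0.
rewrite hdiff_pprods /bar_diff big_ord_recl expr0 mul1r mul1g Hf //.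
exact: mem_head.
Qed.

Definition homog (c : seq T -> R) s : R := if s is [::] then 0 else c (quotients s).

Lemma homog_pprods c a s : homog c (pprods a s) = c s.
Proof. by rewrite /homog /pprods pprodsK. Qed.

Lemma homogM c a s : homog c (map (fun x => a * x)%g s) = homog c s.
Proof.
case: s => // x s; rewrite -[x :: s]quotientsK map_pprods.
by rewrite !homog_pprods.
Qed.

Lemma hdiff_homog c s : hdiff (homog c) s = homog (bar_diff c) s.
Proof.
case: s => // x s; rewrite -[x :: s]quotientsK; move: (quotients _) => {}s.
rewrite -[pprods x s](_ : map (fun y => x * y)%g (pprods 1%g s) = _); last first.
  by rewrite map_pprods mulg1.
rewrite homogM -hdiff_map (eq_hdiff (homogM c x)) homog_pprods -bar_diff_pprods //.
  by case: s => // y s; rewrite /bar_diff; apply: eq_bigr => i _; rewrite homog_pprods.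
by move=> y t _; rewrite !homog_pprods.
Qed.

End PartialProducts.

(** * Locally constant and invariant cochains *)

(** Letterwise relations are expressed as equality of the images under two maps, so
    that congruence modulo [N] and congruence up to a left translation are the
    same kind of hypothesis. *)
Lemma eq_map_rel (A B T T' : Type) (h h' : T -> T') (k k' : T -> A)
    (l l' : T' -> B) (s s' : seq T) :
  (forall x y, k x = k' y -> l (h x) = l' (h' y)) ->
  map k s = map k' s' -> map l (map h s) = map l' (map h' s').
Proof.
move=> hl; elim: s s' => [|x s IH] [|y s'] //= [kxy ks].
by rewrite (hl _ _ kxy) (IH _ ks).
Qed.

Lemma prism_rel (R : comNzRingType) (A T : Type) (q : T -> T) (k k' : T -> A)
    (f f' : seq T -> R) :
  (forall x y, k x = k' y -> k (q x) = k' (q y)) ->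
  (forall s s', map k s = map k' s' -> f s = f' s') ->
  forall s s', map k s = map k' s' -> prism q f s = prism q f' s'.
Proof.
move=> qk ff' s s'; elim: s s' f f' ff' => [|x s IH] [|y s'] f f' ff' //= [kxy ks].
congr (_ - _).
  by apply: ff'; rewrite /= kxy (qk _ _ kxy) (eq_map_rel qk ks).
by apply: IH => // t t' kt; apply: ff'; rewrite /= kxy kt.
Qed.

Lemma map_cosetS (G : topologicalGroupType) (N M : set G) (s s' : seq G) :
  subgroup N -> subgroup M -> N `<=` M ->
  map (coset N) s = map (coset N) s' -> map (coset M) s = map (coset M) s'.
Proof.
move=> gN gM NM E; rewrite -[s]map_id -[s']map_id.
by apply: eq_map_rel E => x y; exact: coset_sub.
Qed.

Section SmoothCochains.
Variables (G : topologicalGroupType) (R : comNzRingType).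
Implicit Types (f : seq G -> R) (N V : set G) (g : G).

Definition ninvariant N f :=
  forall s s', map (coset N) s = map (coset N) s' -> f s = f s'.

Definition linvariant V f :=
  forall g, V g -> forall s, f (map (fun x => g * x)%g s) = f s.

Definition smooth f :=
  [/\ f [::] = 0, exists n, forall s, (n <= size s)%N -> f s = 0 &
      exists2 N, open_normal N & ninvariant N f].

(** The product set [A N]. *)
Definition thicken (A : set G) N : set G := [set x | exists2 a, A a & coset N a x].

Lemma ninvariantS N M f : subgroup N -> subgroup M -> N `<=` M ->
  ninvariant M f -> ninvariant N f.
Proof.
by move=> gN gM NM fM s s' E; apply: fM; exact: map_cosetS E.
Qed.

Lemma linvariantS V W f : V `<=` W -> linvariant W f -> linvariant V f.
Proof. by move=> VW fW g /VW; exact: fW. Qed.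

(** For [u] in a normal subgroup [N], each [u x] lies in [x N], so an [N]-locally
    constant cochain does not see left multiplication by [N] either. *)
Lemma linvariant_thicken N V f : open_normal N -> ninvariant N f ->
  linvariant V f -> linvariant (thicken V N) f.
Proof.
move=> nN fN fV g [v Vv Nvg] s; rewrite -(fV v Vv s); apply: fN.
rewrite -!map_comp; apply: eq_map => x /=.
by apply: cosetM => //; apply/esym/coset_eqP; first exact: open_normal_subgroup.
Qed.

Lemma smoothB f f' : smooth f -> smooth f' -> smooth (fun s => f s - f' s).
Proof.
move=> [f0 [n fn] [N nN fN]] [f0' [n' fn'] [N' nN' fN']]; split.
- by rewrite f0 f0' subrr.
- exists (maxn n n') => s; rewrite geq_max => /andP[sn sn'].
  by rewrite fn // fn' // subrr.
- exists (N `&` N'); first exact: open_normalI.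
  have gI := open_normal_subgroup (open_normalI nN nN').
  move=> s s' E; congr (_ - _).
    exact: (ninvariantS gI (open_normal_subgroup nN) (@subIsetl _ N N') fN) E.
  exact: (ninvariantS gI (open_normal_subgroup nN') (@subIsetr _ N N') fN') E.
Qed.

Lemma smooth0 : smooth (fun=> 0).
Proof. by split; [|exists 0%N|exists setT; first exact: open_normalT]. Qed.

Lemma smoothZ a f : smooth f -> smooth (fun s => a * f s).
Proof.
move=> [f0 [n fn] [N nN fN]]; split; first by rewrite f0 mulr0.
  by exists n => s sn; rewrite fn // mulr0.
by exists N => // s s' E; rewrite (fN s s').
Qed.

Lemma smooth_sum (I : finType) (F : I -> seq G -> R) :
  (forall i, smooth (F i)) -> smooth (fun s => \sum_i F i s).
Proof.
move=> sF; elim: (index_enum I) => [|i r IH].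
  have -> : (fun s => \sum_(i <- [::]) F i s) = fun=> 0.
    by apply/funext => s; rewrite big_nil.
  exact: smooth0.
have -> : (fun s => \sum_(j <- i :: r) F j s) =
          fun s => F i s - (0 - \sum_(j <- r) F j s).
  by apply/funext => s; rewrite big_cons sub0r opprK.
by apply: smoothB => //; apply: smoothB => //; exact: smooth0.
Qed.

Lemma smooth_translate g f : smooth f ->
  smooth (fun s => f (map (fun x => g * x)%g s)).
Proof.
move=> [f0 [n fn] [N nN fN]]; split=> //.
  by exists n => s sn; rewrite fn // size_map.
exists N => // s s' E; apply: fN; apply: eq_map_rel E => x y.
by apply: cosetMl; exact: open_normal_subgroup.
Qed.

Lemma smooth_prism (q : G -> G) N f : smooth f -> open_normal N ->
  ninvariant N f ->
  (forall x y, coset N x = coset N y -> coset N (q x) = coset N (q y)) ->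
  smooth (prism q f).
Proof.
move=> [f0 [n fn] _] nN fN qN; split=> //; last first.
  by exists N => //; exact: prism_rel.
exists n => s; elim: s n f {f0 fN} fn => //= x s IH n f fn ns.
rewrite fn /=; last by rewrite size_map; apply: leq_trans ns _.
rewrite (IH n.-1 (fun u => f (x :: u))) ?subrr // => [t nt|]; last by lia.
by apply: fn => /=; lia.
Qed.

Lemma linvariant_prism (q : G -> G) N V f :
  open_normal N -> ninvariant N f -> linvariant V f ->
  (forall x y, coset N x = coset N y -> coset N (q x) = coset N (q y)) ->
  (forall v x, V v -> coset N (q (v * x)%g) = coset N (v * q x)%g) ->
  linvariant V (prism q f).
Proof.
move=> nN fN fV qN qV v Vv s.
apply: (prism_rel (k := coset N) (k' := fun x => coset N (v * x)%g)).
- by move=> x y /qN ->; exact: qV.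
- move=> t t' tt'; rewrite -(fV v Vv t'); apply: fN.
  by rewrite tt' -map_comp.
- by rewrite -map_comp.
Qed.

End SmoothCochains.

(** * Equivariant retractions onto a closed subgroup *)

Section Retraction.
Variables (G : topologicalGroupType) (P : closedSubgroup G) (N : set G).
Hypothesis nN : open_normal N.
Let gN : subgroup N := open_normal_subgroup nN.

Lemma subgroup_valP (x : P) : (P : set G) (\val x).
Proof. exact: set_mem (valP x). Qed.

Lemma subgroup_lift (x : G) : (P : set G) x -> exists y : P, \val y = x.
Proof. by move=> Px; exists (exist _ x (mem_set Px)). Qed.

(** An equivariant map from [G] to [P] modulo [N]: choose a representative [t] in
    each double coset [P g N], and let [q g] be an element of [P] with [g] in
    [q g t N].  A continuous and strictly equivariant map would amount to a
    continuous section of the quotient of [G] by [P]; equivariance modulo [N]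
    suffices for cochains that are constant modulo [N]. *)
Lemma retraction_mod : exists q : G -> P,
  [/\ coset N (\val (q 1%g)) = coset N 1%g,
      forall v g, (P : set G) v -> coset N (\val (q (v * g)%g)) = coset N (v * \val (q g))%g &
      forall g h, coset N g = coset N h ->
        coset N (\val (q g)) = coset N (\val (q h))].
Proof.
pose D g := [set x | exists2 v, (P : set G) v & coset N x = coset N (v * g)%g].
have DM v g : (P : set G) v -> D (v * g)%g = D g.
  move=> Pv; have gP := closedSubgroup_subgroup P.
  apply/seteqP; split=> x [w Pw xw].
    by exists (w * v)%g; [exact: subgroupM|rewrite -mulgA].
  exists (w * v^-1)%g; first by apply: subgroupM => //; exact: subgroupV.
  by rewrite mulgA mulgVK.
have DN g h : coset N g = coset N h -> D g = D h.
  move=> gh; apply/seteqP; split=> x [w Pw xw]; exists w => //; rewrite xw.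
    exact: cosetMl.
  by apply/esym; exact: cosetMl.
pose t g := xget 1%g (D g).
have tP g : exists v : P, coset N g = coset N (\val v * t g)%g.
  have [v Pv tv] : D g (t g).
    apply: (xgetPex 1%g); exists g; exists 1%g; last by rewrite mul1g.
    exact: (subgroup1 (closedSubgroup_subgroup P)).
  have [w wv] := subgroup_lift (subgroupV (closedSubgroup_subgroup P) Pv).
  exists w; rewrite wv -[g in LHS](mulKg v).
  by apply/esym; exact: cosetMl.
pose q g := xget 1%g [set v : P | coset N g = coset N (\val v * t g)%g].
have qP g : coset N g = coset N (\val (q g) * t g)%g.
  by apply: (xgetPex 1%g (P := [set v : P | coset N g = coset N (\val v * t g)%g])); exact: tP.
have cancel x y z : coset N (x * z)%g = coset N (y * z)%g -> coset N x = coset N y.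
  move=> E; rewrite -[x](mulgK z) -[y](mulgK z).
  exact: cosetM.
have qM v g : (P : set G) v -> coset N (\val (q (v * g)%g)) = coset N (v * \val (q g))%g.
  move=> Pv; apply: (cancel _ _ (t g)).
  have -> : t g = t (v * g)%g by rewrite /t DM.
  by rewrite -qP -mulgA /t DM // -/(t g); apply: cosetMl.
(* The right factor normalises the value at 1 and keeps left equivariance. *)
exists (fun g => q g * (q 1)^-1)%g; split=> [|v g Pv|g h gh].
- by rewrite mulgV.
- rewrite !gmulfM mulgA; exact: (cosetM nN (qM v g Pv) erefl).
- rewrite !gmulfM; apply: cosetM => //; apply: (cancel _ _ (t g)).
  by rewrite -qP gh qP /t (DN _ _ gh).
Qed.
End Retraction.

(** * Restriction to a closed subgroup *)

(** [filterS], with the filter fixed to the neighbourhoods of a point. *)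
Lemma near_imply (T : topologicalType) (x : T) (A B : T -> Prop) :
  (forall y, A y -> B y) -> (\forall y \near x, A y) -> \forall y \near x, B y.
Proof. exact: filterS. Qed.

Lemma near_cosets (T : topologicalType) (G : topologicalGroupType) (I : finType)
    (f : I -> T -> G) (x : T) (N : set G) :
  open_normal N -> (forall i, continuous (f i)) ->
  \forall y \near x, forall i, coset N (f i y) = coset N (f i x).
Proof.
move=> nN cf; apply: filter_forall => i.
have : nbhs x (f i @^-1` coset N (f i x)) by apply: cf; exact: coset_nbhs.
apply: filterS => y Ny.
by apply/esym/coset_eqP => //; exact: open_normal_subgroup.
Qed.

Lemma pprods_coset (G : topologicalGroupType) (N : set G) (a a' : G)
    (s s' : seq G) : open_normal N ->
  coset N a = coset N a' -> map (coset N) s = map (coset N) s' ->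
  map (coset N) (pprods a s) = map (coset N) (pprods a' s').
Proof.
move=> nN; elim: s s' a a' => [|x s IH] [|y s'] a a' //= aa'; first by rewrite aa'.
by move=> [xy ss]; rewrite aa'; congr cons; apply: IH => //; exact: cosetM.
Qed.

Lemma smooth_continuous_cochain (G H : topologicalGroupType) (R : comNzRingType)
    (j : H -> G) (f : seq G -> R) : continuous j -> smooth f ->
  continuous_cochain (fun s => f (pprods 1%g (map j s))).
Proof.
move=> cj [f0 [n fn] [N nN fN]]; split=> [m|]; last first.
  exists n => s ns; apply: fn; rewrite /= size_scanl size_map; exact: leqW.
apply/continuous_discreteP => x.
have cv i : continuous (fun y : {ptws 'I_m -> H} => j (y i)).
  move=> y; apply: (continuous_comp (f := fun y : {ptws 'I_m -> H} => y i)
    (g := j)); last exact: cj.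
  exact: (@proj_continuous 'I_m (fun=> H) i).
have := near_cosets x nN cv; apply: near_imply => y xy.
apply: fN; apply: pprods_coset => //.
rewrite /codom /image_mem -!map_comp; apply: eq_map => i /=.
by rewrite xy.
Qed.

Section RestrictionToSubgroup.
Variables (G : topologicalGroupType) (P : closedSubgroup G) (R : comNzRingType).
Implicit Types (f : seq G -> R) (s : seq P) (N : set G).

Definition words_val s : seq G := map (fun x : P => \val x) s.

Definition restriction f s : R := f (pprods 1%g (words_val s)).

Lemma restriction_continuous f : smooth f -> continuous_cochain (restriction f).
Proof. by apply: smooth_continuous_cochain; exact: subgroup_val_continuous. Qed.

Definition restriction_cochain f (sf : smooth f) : cochain P R :=
  exist _ (restriction f) (mem_set (restriction_continuous sf)).

Lemma words_val_pprods (x : P) s : pprods (\val x) (words_val s) = words_val (pprods x s).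
Proof.
elim: s x => // y s IH x.
by rewrite pprods_cons -[RHS]/(\val x :: words_val (pprods (x * y)%g s)) -IH gmulfM.
Qed.

Lemma linvariant_pprods f (x : P) s : linvariant P f ->
  f (pprods (\val x) (words_val s)) = restriction f s.
Proof.
move=> fP; rewrite -[RHS](fP _ (subgroup_valP x)).
by rewrite map_pprods mulg1.
Qed.

Lemma bar_diff_restriction f s : f [::] = 0 -> linvariant P f ->
  bar_diff (restriction f) s = restriction (hdiff f) s.
Proof.
move=> f0 fP.
have E (y : P) t : f (words_val (pprods y t)) = restriction f t.
  by rewrite -words_val_pprods linvariant_pprods.
rewrite -[RHS]/(hdiff f (pprods (\val (1%g : P)) (words_val s))) words_val_pprods.
rewrite -hdiff_map -bar_diff_pprods //.
  case: s => // x s; apply: eq_bigr => i _.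
  by congr (_ * _); exact: esym (E _ _).
by move=> x t _; exact: etrans (E _ _) (esym (E _ _)).
Qed.

End RestrictionToSubgroup.

(** * Uniform local constancy of continuous cochains *)

Lemma codom_nth (T : Type) (x : T) n (s : seq T) : size s = n ->
  codom (fun i : 'I_n => nth x s i) = s.
Proof.
move=> sn; apply: (@eq_from_nth _ x); rewrite size_codom card_ord // => i Hi.
by rewrite (nth_codom_ord _ _ Hi).
Qed.

Section UniformContinuity.
Variables (G : topologicalGroupType) (P : closedSubgroup G).
Hypothesis profG : profinite G.

Lemma nbhs_coset_sub (x : P) (W : set P) : nbhs x W ->
  exists2 N, open_normal N &
    forall y : P, coset N (\val x) = coset N (\val y) -> W y.
Proof.
move=> [V /= [[O oO <-] /= Ox OW]].
have nO : nbhs (1%g : G) [set h | O (\val x * h)%g].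
  have := @mulg_continuousl G (\val x) 1%g; rewrite /continuous_at mulg1.
  by move=> cx; apply: cx; exact: open_nbhs_nbhs.
have [N nN NO] := open_normal_base profG nO.
exists N => // y /(coset_eqP _ _ (open_normal_subgroup nN))/NO /=.
by rewrite mulVKg => Oy; apply: OW.
Qed.

(** The boxes cut out by cosets of a single [N] generate a filter that converges
    in each coordinate, hence in the product topology. *)
Lemma ptws_nbhs_coset_sub n (x : {ptws 'I_n -> P}) (A : set {ptws 'I_n -> P}) :
  nbhs x A -> exists2 N, open_normal N &
    forall y : {ptws 'I_n -> P},
      (forall i, coset N (\val (x i)) = coset N (\val (y i))) -> A y.
Proof.
pose F := filter_from (@open_normal G) (fun N => [set y : {ptws 'I_n -> P} |
  forall i, coset N (\val (x i)) = coset N (\val (y i))]).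
have FF : Filter F.
  apply: filter_from_filter; first by exists setT; exact: open_normalT.
  move=> N M nN nM; have nI := open_normalI nN nM; exists (N `&` M) => // y xy.
  split=> i; apply: coset_sub (xy i); try exact: open_normal_subgroup.
    exact: subIsetl.
  exact: subIsetr.
suff Fx : F --> x by move=> /Fx[N nN NA]; exists N => // y; exact: NA.
apply/cvg_sup => i B [V /= [[O oO <-] /= Oxi OB]].
have [N nN NO] : exists2 N, open_normal N & forall y : P,
    coset N (\val (x i)) = coset N (\val y) -> O y.
  by apply: nbhs_coset_sub; exact: open_nbhs_nbhs.
by exists N => // y xy; apply: OB; apply: NO; exact: xy.
Qed.

(** Continuity gives an [N] near each word; compactness of the words of a fixed
    length in [P] gives one [N] per degree, and only finitely many degrees matter.
    Compactness is used for words in [G] with letters in [P], where Tychonoff's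
    theorem applies to closed subsets directly. *)
Lemma cochain_locally_constant (R : comNzRingType) (c : cochain P R) :
  exists2 N, open_normal N & forall s s' : seq P,
    map (coset N) (words_val s) = map (coset N) (words_val s') ->
    val c s = val c s'.
Proof.
have degreewise n : exists2 N, open_normal N & forall s s' : seq P, size s = n ->
    map (coset N) (words_val s) = map (coset N) (words_val s') ->
    val c s = val c s'.
  pose K := [set x : {ptws 'I_n -> G} | forall i, (P : set G) (x i)].
  have cK : compact K.
    apply: (@tychonoff 'I_n (fun=> G) (fun=> P : set G)) => i.
    by case: profG => cG _ _; apply: subclosed_compact cG _ => //; exact: closedSubgroup_closed.
  pose C (N : set G) (x : {ptws 'I_n -> G}) := forall s s' : seq P, words_val s = codom x ->
    map (coset N) (words_val s) = map (coset N) (words_val s') -> val c s = val c s'.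
  have [|||N nN NC] := @compact_eventually _ _ (@open_normal G) K C cK; first last.
  - exists N => // s s' sn.
    apply: (NC (fun i => nth 1%g (words_val s) i)).
      move=> i; rewrite (nth_map 1%g) ?sn //; exact: subgroup_valP.
    by rewrite codom_nth // size_map.
  - move=> x Kx.
    (* The same word, with its letters taken in the subgroup type. *)
    have [y yx] : exists y : {ptws 'I_n -> P}, forall i, \val (y i) = x i.
      exists (fun i => xget 1%g [set v : P | \val v = x i]) => i.
      apply: (xgetPex 1%g (P := [set v : P | \val v = x i])).
      exact: subgroup_lift.
    have cc := (cochainP c).1 n.
    have [N nN NC] := ptws_nbhs_coset_sub ((continuous_discreteP _).1 cc y).
    have NC' (s : seq P) : size s = n -> (forall i : 'I_n,
        coset N (x i) = coset N (nth 1%g (words_val s) i)) -> val c s = val c (codom y).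
      move=> sn sx; rewrite -[s](codom_nth 1%g sn); apply: NC => i.
      by rewrite yx sx (nth_map 1%g) // sn.
    exists N => //.
    have := near_cosets (f := fun i (z : {ptws 'I_n -> G}) => z i) x nN
      (fun i => @proj_continuous 'I_n (fun=> G) i).
    apply: near_imply => z xz B nB BN s s' sz ss'.
    have sn : size s = n by rewrite -(size_map (fun v : P => \val v)) -/(words_val s) sz size_codom card_ord.
    have sn' : size s' = n.
      by move/(congr1 size): ss'; rewrite !size_map sn.
    have szi (i : 'I_n) : nth 1%g (words_val s) i = z i.
      by rewrite sz nth_codom_ord; congr z; exact: val_inj.
    rewrite !NC' // => i; rewrite -xz -szi //.
    have gB := open_normal_subgroup nB; have gN := open_normal_subgroup nN.
    apply: (coset_sub gB gN BN).
    move/(congr1 (fun w => nth set0 w i)): ss'.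
    by rewrite !(nth_map 1%g) ?size_map ?sn ?sn'.
  - move=> A B nA nB; exists (A `&` B) => //; exact: open_normalI.
  - by exists setT; exact: open_normalT.
have [m cm] := (cochainP c).2.
have [N nN NC] : exists2 N, open_normal N & forall s s' : seq P, (size s < m)%N ->
    map (coset N) (words_val s) = map (coset N) (words_val s') ->
    val c s = val c s'.
  elim: m {cm} => [|m [N nN NC]]; first by exists setT => //; exact: open_normalT.
  have [M nM MC] := degreewise m.
  have nI := open_normalI nN nM; have gI := open_normal_subgroup nI.
  exists (N `&` M) => // s s'; rewrite ltnS leq_eqVlt => /orP[/eqP sm|sm] E.
    exact: (MC _ _ sm (map_cosetS gI (open_normal_subgroup nM) (@subIsetr _ N M) E)).
  exact: (NC _ _ sm (map_cosetS gI (open_normal_subgroup nN) (@subIsetl _ N M) E)).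
exists N => // s s' ss'; have [sm|sm] := ltnP (size s) m; first exact: NC.
rewrite !cm //; move/(congr1 size): ss'; rewrite !size_map => <- //.
Qed.

End UniformContinuity.

(** * Invariant cochains on G compute the cohomology of a subgroup *)

Section Extension.
Variables (G : topologicalGroupType) (P : closedSubgroup G) (R : comNzRingType).
Variables (N : set G) (q : G -> P).
Hypothesis nN : open_normal N.
Hypothesis q1 : coset N (\val (q 1%g)) = coset N 1%g.
Hypothesis qM : forall v g, (P : set G) v ->
  coset N (\val (q (v * g)%g)) = coset N (v * \val (q g))%g.
Hypothesis qN : forall g h, coset N g = coset N h ->
  coset N (\val (q g)) = coset N (\val (q h)).
Variable c : seq P -> R.
Hypothesis cN : forall s s', map (coset N) (words_val s) = map (coset N) (words_val s') ->
  c s = c s'.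

(** A cochain of [P] extended to [G] along [q].  Although [q] is not a morphism, the
    extension commutes with the differentials, since homogeneous differentials
    only omit letters. *)
Definition extend (s : seq G) : R := homog c (map q s).

Lemma homog_coset s s' : map (coset N) (words_val s) = map (coset N) (words_val s') ->
  homog c s = homog c s'.
Proof.
case: s s' => [|x s] [|x' s'] // [xx' ss']; apply: cN.
rewrite /quotients; elim: s s' x x' xx' ss' => [|y s IH] [|y' s'] x x' xx' //= [yy' ss'].
rewrite (IH _ _ _ yy' ss'); congr cons.
rewrite -[LHS]/(coset N (\val (x^-1 * y)%g)) -[RHS]/(coset N (\val (x'^-1 * y')%g)).
by rewrite !gmulfM !gmulfV; apply: cosetM => //; exact: cosetV.
Qed.

Lemma ninvariant_extend : ninvariant N extend.
Proof.
move=> s s' ss'; apply: homog_coset; rewrite /words_val -!map_comp.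
rewrite !(map_comp (coset N) (fun x => \val (q x))).
exact: eq_map_rel ss'.
Qed.

Lemma smooth_extend n : (forall s, (n <= size s)%N -> c s = 0) -> smooth extend.
Proof.
move=> cn; split=> //; last by exists N => //; exact: ninvariant_extend.
exists n.+1 => -[|x s] //= ns; apply: cn.
by rewrite size_pairmap size_map.
Qed.

Lemma linvariant_extend : linvariant P extend.
Proof.
move=> v Pv s; have [w wv] := subgroup_lift Pv.
rewrite /extend -[RHS](homogM c w); apply: homog_coset.
rewrite /words_val -!map_comp; apply: eq_map => x /=.
rewrite qM // -wv.
by rewrite -[RHS]/(coset N (\val (w * q x)%g)) gmulfM.
Qed.

Lemma restrict_extend s : restriction extend s = c s.
Proof.
rewrite -[RHS](homog_pprods c 1%g) /restriction.
rewrite -[pprods _ _]/(pprods (\val (1%g : P)) (words_val s)) words_val_pprods.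
apply: homog_coset; rewrite /words_val -!map_comp; apply: eq_map => x /=.
rewrite -[\val x]mulg1 qM; last exact: subgroup_valP.
exact: cosetMl (open_normal_subgroup nN) q1.
Qed.

Lemma hdiff_extend s : hdiff extend s = homog (bar_diff c) (map q s).
Proof. by rewrite hdiff_map hdiff_homog. Qed.

End Extension.

Section RestrictionIso.
Variables (G : topologicalGroupType) (P : closedSubgroup G) (R : comNzRingType).
Hypothesis profG : profinite G.

Lemma cocycle_extend (c : cochain P R) : bar_diff (val c) =1 (fun=> 0) ->
  exists f : seq G -> R, [/\ smooth f, linvariant P f, hdiff f =1 (fun=> 0) &
    restriction (P := P) f =1 val c].
Proof.
move=> dc; have [N nN cN] := cochain_locally_constant profG c.
have [q [q1 qM qN]] := retraction_mod P nN.
have [n cn] := (cochainP c).2.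
exists (extend q (val c)); split.
- exact: (smooth_extend nN qN cN cn).
- exact: (linvariant_extend nN qM cN).
- by move=> s; rewrite hdiff_extend; case: s => // x s; rewrite /homog dc.
- exact: (restrict_extend nN q1 qM cN).
Qed.

(** If [w] bounds the restriction of [f], then [extend q w] bounds [f] composed with
    the retraction [q], and the prism operator bounds the difference between the
    latter and [f]. *)
Lemma restriction_exact (f : seq G -> R) (w : cochain P R) :
  smooth f -> linvariant P f -> hdiff f =1 (fun=> 0) ->
  restriction f =1 bar_diff (val w) ->
  exists h : seq G -> R, [/\ smooth h, linvariant P h & hdiff h =1 f].
Proof.
move=> sf fP df fw.
have [_ _ [N1 nN1 fN1]] := sf.
have [N2 nN2 wN2] := cochain_locally_constant profG w.
have nN := open_normalI nN1 nN2; set N := N1 `&` N2 in nN.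
have gN := open_normal_subgroup nN.
have fN : ninvariant N f.
  exact: (ninvariantS gN (open_normal_subgroup nN1) (@subIsetl _ N1 N2) fN1).
have wN (s s' : seq P) : map (coset N) (words_val s) = map (coset N) (words_val s') ->
    val w s = val w s'.
  move=> E; apply: wN2.
  exact: map_cosetS (open_normal_subgroup nN2) (@subIsetr _ N1 N2) E.
have [q [q1 qM qN]] := retraction_mod P nN.
have [n wn] := (cochainP w).2.
pose tau x := \val (q x).
exists (fun s => extend q (val w) s - prism tau f s); split.
- apply: smoothB; first exact: (smooth_extend nN qN wN wn).
  exact: (smooth_prism sf nN fN).
- move=> v Pv s; congr (_ - _); first exact: (linvariant_extend nN qM wN).
  exact: (linvariant_prism nN fN fP qN (fun v x Pv => qM v x Pv)).
move=> s; rewrite hdiffB hdiff_extend.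
have := hdiff_prism tau f s; rewrite [prism tau (hdiff f) s]prism0 // addr0 => ->.
suff -> : homog (bar_diff (val w)) (map q s) = f (map tau s) by ring.
have -> : map tau s = words_val (map q s) by rewrite /words_val -map_comp.
case: (map q s) => [|x t]; first by case: sf.
rewrite -(quotientsK x t) homog_pprods -fw.
by rewrite -words_val_pprods linvariant_pprods.
Qed.

End RestrictionIso.

(** * Transfer over a finite set of cosets *)

Section Transversal.
Variables (G : topologicalGroupType) (U : set G).
Hypothesis gU : subgroup U.

Lemma index_transversal n : has_index U n -> exists r : 'I_n -> G,
  (forall x, exists i, coset U (r i) x) /\
  (forall i j, coset U (r i) (r j) -> i = j).
Proof.
have cosetE g : [set (g * u)%g | u in U] = coset U g.
  apply/seteqP; split=> x; first by case=> u Uu <-; rewrite /coset /= mulKg.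
  by rewrite /coset /= => Ux; exists (g^-1 * x)%g => //; rewrite mulVKg.
move=> /card_set_bijP[f [ff finj fsurj]].
have rP (i : 'I_n) : exists g, f (coset U g) = i :> nat.
  have [C [g _ <-] fC] := fsurj i (ltn_ord i).
  by exists g; rewrite -cosetE.
have [r rE] := choice rP; exists r; split=> [x|i j].
  have fx : (f (coset U x) < n)%N.
    by rewrite -cosetE; apply: ff; exists x.
  exists (Ordinal fx); apply/coset_eqP => //; apply: finj.
  - by apply/mem_set; rewrite -cosetE; exists (r (Ordinal fx)).
  - by apply/mem_set; rewrite -cosetE; exists x.
  - by rewrite rE.
by move=> /(coset_eqP _ _ gU) rij; apply: val_inj; rewrite /= -!rE rij.
Qed.

Variables (R : comNzRingType) (n : nat) (r : 'I_n -> G).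
Hypothesis r_cover : forall x, exists i, coset U (r i) x.
Hypothesis r_inj : forall i j, coset U (r i) (r j) -> i = j.
Implicit Types f : seq G -> R.

Lemma sum_transversal (F : G -> R) g : (forall x u, U u -> F (x * u)%g = F x) ->
  \sum_i F (g * r i)%g = \sum_i F (r i).
Proof.
move=> FU; have [idx idxP] := choice r_cover.
have Fidx x : F x = F (r (idx x)).
  by have := FU (r (idx x)) _ (idxP x); rewrite mulVKg.
rewrite [RHS](reindex_inj (h := fun i => idx (g * r i)%g)).
  by apply: eq_bigr => i _; exact: Fidx.
move=> i j ij; apply: r_inj; apply/(coset_eqP _ _ gU).
have idxE x : coset U (r (idx x)) = coset U x by apply/(coset_eqP _ _ gU); exact: idxP.
rewrite -[r i](mulKg g) -[r j](mulKg g). apply: cosetMl => //.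
by rewrite -(idxE (g * r i)%g) ij idxE.
Qed.

Definition transfer f s := \sum_i f (map (fun x => (r i)^-1 * x)%g s).

Lemma smooth_transfer f : smooth f -> smooth (transfer f).
Proof. by move=> sf; apply: smooth_sum => i; exact: smooth_translate. Qed.

Lemma hdiff_transfer f s : hdiff (transfer f) s = transfer (hdiff f) s.
Proof.
rewrite [LHS](hdiff_sum (fun i s => f (map (fun x => (r i)^-1 * x)%g s))).
by apply: eq_bigr => i _; rewrite hdiff_map.
Qed.

Lemma transferT f s : linvariant setT f -> transfer f s = n%:R * f s.
Proof.
move=> fT; rewrite /transfer (eq_bigr (fun=> f s)) => [|i _]; last exact: fT.
by rewrite sumr_const card_ord mulr_natl.
Qed.

Lemma linvariant_transfer f : linvariant U f -> linvariant setT (transfer f).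
Proof.
move=> fU g _ s.
pose F x := f (map (fun y => x^-1 * y)%g s).
rewrite /transfer -[RHS](sum_transversal (F := F) (g^-1)%g).
  apply: eq_bigr => i _; rewrite /F -map_comp; congr f; apply: eq_map => y /=.
  by rewrite invgM invgK mulgA.
move=> x u Uu; rewrite /F -[RHS](fU (u^-1)%g); last exact: (subgroupV gU).
by rewrite -map_comp; congr f; apply: eq_map => y /=; rewrite invgM mulgA.
Qed.

(** Writing each [g] as [a d u] with [d] a representative of [U g U] and [a], [u] in
    [U], the cochain [W g = psi d (a^-1 _)] is independent of the choice of [a],
    because [psi d] is invariant under the intersection of [U] and [d U d^-1].  Hence
    [W (u g u')] is the translate of [W g] by [u], and the sum of [W] over
    [G / U] is well defined and [U]-invariant. *)
Lemma transfer_homotopy f : linvariant U f ->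
  (forall g, exists h, [/\ smooth h, linvariant [set u | U u /\ U (g^-1 * u * g)%g] h &
    forall s, hdiff h s = f (map (fun x => g^-1 * x)%g s) - f s]) ->
  exists h, [/\ smooth h, linvariant U h &
    forall s, hdiff h s = transfer f s - n%:R * f s].
Proof.
move=> fU /choice[psi psiP].
pose D g := [set x | exists2 u, U u & exists2 u', U u' & x = (u * g * u')%g].
have U1 : U 1%g by exact: subgroup1.
have DM u u' g : U u -> U u' -> D (u * g * u')%g = D g.
  move=> Uu Uu'; apply/seteqP; split=> x [v Uv [v' Uv' ->]].
    exists (v * u)%g; first exact: subgroupM.
    by exists (u' * v')%g; [exact: subgroupM|rewrite !mulgA].
  exists (v * u^-1)%g; first by apply: subgroupM => //; exact: subgroupV.
  exists (u'^-1 * v')%g; first by apply: subgroupM => //; exact: subgroupV.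
  by rewrite !mulgA mulgVK mulgK.
pose d g := xget 1%g (D g).
pose A g := [set a | U a /\ U ((a * d g)^-1 * g)%g].
pose a g := xget 1%g (A g).
have aP g : A g (a g).
  apply: (xgetPex 1%g).
  have [u Uu [u' Uu' du]] : D g (d g).
    apply: (xgetPex 1%g); exists g; exists 1%g => //; exists 1%g => //.
    by rewrite mul1g mulg1.
  exists (u^-1)%g; split; first exact: (subgroupV gU).
  have -> : ((u^-1 * d g)^-1 * g = u'^-1)%g.
    by rewrite du !mulgA mulVg mul1g invgM mulgVK.
  exact: subgroupV.
pose W g s := psi (d g) (map (fun x => (a g)^-1 * x)%g s).
have hdiffW g s : hdiff (W g) s = f (map (fun x => g^-1 * x)%g s) - f s.
  have [Ua Uag] := aP g; have [_ _ hpsi] := psiP (d g).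
  rewrite /W hdiff_map hpsi (fU _ (subgroupV gU Ua)).
  congr (_ - _); rewrite -(fU _ Uag (map _ s)) -!map_comp.
  by congr f; apply: eq_map => x /=; rewrite !mulgA mulgK invgM.
have WM u u' g s : U u -> U u' ->
    W (u * g * u')%g (map (fun x => u * x)%g s) = W g s.
  move=> Uu Uu'; rewrite /W /d DM // -/(d g).
  have [Ua Uag] := aP g; have := aP (u * g * u')%g.
  rewrite /A /= /d DM // -/(d g) => -[Ua' Uag'].
  set a' := a (u * g * u')%g in Ua' Uag' *.
  have [_ psiU _] := psiP (d g).
  rewrite -[RHS](psiU (a'^-1 * u * a g)%g).
    by rewrite -!map_comp; congr psi; apply: eq_map => x /=; rewrite !mulgA mulgK.
  split; first exact: (subgroupM gU (subgroupM gU (subgroupV gU Ua') Uu) Ua).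
  have -> : ((d g)^-1 * (a'^-1 * u * a g) * d g =
      ((a' * d g)^-1 * (u * g * u')) * u'^-1 * ((a g * d g)^-1 * g)^-1)%g.
    by rewrite !invgM !invgK !mulgA !(mulgK, mulgVK).
  exact: (subgroupM gU (subgroupM gU Uag' (subgroupV gU Uu')) (subgroupV gU Uag)).
exists (fun s => \sum_i W (r i) s); split.
- apply: smooth_sum => i; apply: smooth_translate.
  by have [] := psiP (d (r i)).
- move=> u Uu s.
  pose F x := W x (map (fun y => u * y)%g s).
  rewrite -[LHS]/(\sum_i F (r i)) -(sum_transversal (F := F) u).
    by apply: eq_bigr => i _; rewrite /F -[(u * _)%g]mulg1 WM.
  move=> x v Uv; rewrite /F.
  have sE : map (fun y => u * y)%g s = map (fun y => 1 * y)%g (map (fun y => u * y)%g s).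
    by rewrite -map_comp; apply: eq_map => y /=; rewrite mul1g.
  by rewrite {1}sE -[x in LHS]mul1g WM.
- move=> s; rewrite (hdiff_sum (fun i => W (r i))).
  under eq_bigr do rewrite hdiffW.
  by rewrite sumrB sumr_const card_ord mulr_natl.
Qed.

End Transversal.

(** * From closed subgroups to open subgroups *)

Section Thickening.
Variable G : topologicalGroupType.
Implicit Types (A B N : set G).

Lemma sub_thicken A N : open_normal N -> A `<=` thicken A N.
Proof.
by move=> nN x Ax; exists x => //; rewrite /coset /= mulVg; exact: (subgroup1 (open_normal_subgroup nN)).
Qed.

Lemma thickenP A N x : open_normal N ->
  thicken A N x <-> exists2 a, A a & coset N a = coset N x.
Proof.
move=> nN; have gN := open_normal_subgroup nN.
by split=> -[a Aa /(coset_eqP _ _ gN) ?]; exists a.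
Qed.

Lemma thickenS A N M : N `<=` M -> thicken A N `<=` thicken A M.
Proof. by move=> NM x [a Aa Nax]; exists a => //; exact: NM. Qed.

Lemma open_thicken A N : open_normal N -> open (thicken A N).
Proof.
move=> nN; have gN := open_normal_subgroup nN.
rewrite openE => x /(thickenP _ _ nN)[a Aa ax].
apply: filterS (coset_nbhs x nN) => y /(coset_eqP _ _ gN) xy.
by apply/thickenP => //; exists a => //; rewrite ax.
Qed.

Lemma subgroup_thicken A N : open_normal N -> subgroup A -> subgroup (thicken A N).
Proof.
move=> nN gA; apply: subgroupP.
- by apply: sub_thicken => //; exact: subgroup1.
- move=> x y /(thickenP _ _ nN)[a Aa ax] /(thickenP _ _ nN)[b Ab bY].
  apply/thickenP => //; exists (a * b)%g; first exact: subgroupM.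
  exact: cosetM.
- move=> x /(thickenP _ _ nN)[a Aa ax]; apply/thickenP => //.
  by exists (a^-1)%g; [exact: subgroupV|exact: cosetV].
Qed.

Hypothesis profG : profinite G.

(** Since [A] and [B] are closed, the sets [A N] and [B N] shrink to [A] and [B]
    near every point; the complement of the open set on the right is compact, so
    one [N] is small enough. *)
Lemma thickenI A B M : closed A -> closed B -> open_normal M ->
  exists2 N, open_normal N & thicken A N `&` thicken B N `<=` thicken (A `&` B) M.
Proof.
move=> cA cB nM.
have far (C : set G) x : closed C -> ~ C x -> exists2 N, open_normal N &
    forall y, coset N x y -> ~ thicken C N y.
  move=> cC nCx.
  have : nbhs (1%g : G) [set h | (~` C) (x * h)%g].
    have := @mulg_continuousl G x 1%g; rewrite /continuous_at mulg1.
    by move=> cx; apply: cx; apply: open_nbhs_nbhs; split=> //; exact: closed_openC.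
  move=> /(open_normal_base profG)[N nN NC]; exists N => // y xy.
  have gN := open_normal_subgroup nN.
  move=> /(thickenP _ _ nN)[c Cc cy].
  have /NC : N (x^-1 * c)%g.
    by apply/(coset_eqP _ _ gN); rewrite cy; apply/coset_eqP.
  by rewrite /= mulVKg.
have [|||x nx|N nN NK] := @compact_eventually _ _ (@open_normal G)
    (~` thicken (A `&` B) M) (fun N x => ~ (thicken A N `&` thicken B N) x).
- case: profG => cG _ _; apply: subclosed_compact cG _ => //.
  by apply: open_closedC; exact: open_thicken.
- by exists setT; exact: open_normalT.
- by move=> N N' nN nN'; exists (N `&` N') => //; exact: open_normalI.
- have : ~ (A `&` B) x by move=> ABx; apply: nx; exact: sub_thicken.
  move=> /not_andP[] nCx.
    have [N nN NA] := far _ _ cA nCx; exists N => //.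
    apply: filterS (coset_nbhs x nN) => y xy N' _ N'N [/(thickenS N'N) Ny _].
    exact: NA xy Ny.
  have [N nN NB] := far _ _ cB nCx; exists N => //.
  apply: filterS (coset_nbhs x nN) => y xy N' _ N'N [_ /(thickenS N'N) Ny].
  exact: NB xy Ny.
by exists N => // x Nx; apply: contrapT => nx; exact: NK nx Nx.
Qed.

(** Both [f] and the cochain [h] found at [g] are constant modulo open normal
    subgroups, so by [thickenI] the same [h] serves [thicken S N] and all elements
    near [g], for [N] small.  Compactness of [G] makes [N] uniform. *)
Lemma uniform_homotopy (R : comNzRingType) (S : set G) (f : seq G -> R) :
  closed S -> smooth f ->
  (forall g, exists h, [/\ smooth h, linvariant [set u | S u /\ S (g^-1 * u * g)%g] h &
    forall s, hdiff h s = f (map (fun x => g^-1 * x)%g s) - f s]) ->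
  exists N, [/\ open_normal N, ninvariant N f & forall g, exists h,
    [/\ smooth h, linvariant [set u | thicken S N u /\ thicken S N (g^-1 * u * g)%g] h &
    forall s, hdiff h s = f (map (fun x => g^-1 * x)%g s) - f s]].
Proof.
move=> cS [_ _ [N0 nN0 fN0]] psi.
have [||||N [nN NN0] Npsi] := @compact_eventually _ _
    [set N | open_normal N /\ N `<=` N0] [set: G]
    (fun N g => exists h, [/\ smooth h,
      linvariant [set u | thicken S N u /\ thicken S N (g^-1 * u * g)%g] h &
      forall s, hdiff h s = f (map (fun x => g^-1 * x)%g s) - f s]).
- by case: profG.
- by exists N0; split.
- move=> N N' [nN NN0] [nN' _]; exists (N `&` N') => //; split; first exact: open_normalI.
  by move=> x [/NN0].
- move=> g _; have [h [sh hS hdh]] := psi g.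
  have [_ _ [M nM hM]] := sh.
  pose S' := [set u | S (g^-1 * u * g)%g].
  have cS' : closed S'.
    apply: (@closed_comp _ _ (fun u : G => g^-1 * u * g)%g S) => // u _.
    apply: continuous_mulg; last exact: cst_continuous.
    by apply: continuous_mulg; [exact: cst_continuous|move=> x; exact: cvg_id].
  have [N1 nN1 N1M] := thickenI cS cS' nM.
  have nN := open_normalI nN0 nN1; set N := N0 `&` N1 in nN.
  have gN := open_normal_subgroup nN.
  exists N; first by split=> //; exact: subIsetl.
  apply: filterS (coset_nbhs g nN) => g' /(coset_eqP _ _ gN) gg' B [nB BN0] BN.
  have gB := open_normal_subgroup nB.
  exists h; split=> //.
    apply: linvariantS (linvariant_thicken nM hM hS) => u [SBu SBu'].
    apply: N1M; split.
      by apply: thickenS SBu => x /BN[].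
    apply: (@thickenS _ N); first exact: subIsetr.
    apply/thickenP => //.
    have /(thickenP _ _ nB)[v Sv vu] := SBu'.
    exists (g * v * g^-1)%g; first by rewrite /S' /= !mulgA mulVg mul1g mulgVK.
    have gv : coset N v = coset N (g^-1 * u * g)%g.
      rewrite (coset_sub gB gN BN vu).
      by apply: cosetM => //; apply: cosetM => //; exact: cosetV.
    have -> : u = (g * (g^-1 * u * g) * g^-1)%g by rewrite !mulgA mulgV mul1g mulgK.
    by apply: cosetM => //; exact: cosetMl.
  move=> s; rewrite hdh; congr (_ - _); apply: fN0.
  rewrite -!map_comp; apply: eq_map => x /=.
  apply: cosetM => //; apply: cosetV => //.
  exact: (coset_sub gN (open_normal_subgroup nN0) (@subIsetl _ N0 N1)).
exists N; split=> //; last by move=> g; exact: Npsi.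
exact: (ninvariantS (open_normal_subgroup nN) (open_normal_subgroup nN0) NN0 fN0).
Qed.

End Thickening.

(** * Restriction onto the stable elements *)

Section SubgroupInclusion.
Variables (G : topologicalGroupType) (S : closedSubgroup G).

Definition subgroup_incl (x : S) : G := \val x.

Lemma subgroup_inclM : {morph subgroup_incl : x y / (x * y)%g}.
Proof. by move=> x y; exact: gmulfM. Qed.

HB.instance Definition _ := @isContinuous.Build S G subgroup_incl
  (@subgroup_val_continuous G S).
HB.instance Definition _ := isMultiplicative.Build S G subgroup_incl
  subgroup_inclM.

End SubgroupInclusion.

Lemma val_cocycle_pullback (G H : topologicalGroupType) (R : nzRingType)
    (phi : continuousHomType G H) (z : cocycle H R) s :
  val (val (cocycle_pullback phi z)) s = val (val z) (map phi s).
Proof. by []. Qed.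

Section Cocycles.
Variables (G : topologicalGroupType) (R : comNzRingType).

Lemma class_of_eqP (z z' : cocycle G R) : class_of z = class_of z' <->
  exists w : cochain G R, forall s,
    val (val z) s - val (val z') s = bar_diff (val w) s.
Proof.
have zB : val (z - z') = val z - val z' by rewrite raddfB.
rewrite class_of_eq; split=> [/asboolP[w zw]|[w zw]]; last apply/asboolP; exists w.
  by move=> s; rewrite -val_coboundary -zw zB cochainB.
by rewrite zB; apply: cochain_inj => s; rewrite cochainB zw.
Qed.

Lemma class_of_eq0P (z : cocycle G R) : class_of z = 0 <->
  exists w : cochain G R, forall s, val (val z) s = bar_diff (val w) s.
Proof.
have z0 s : val (val z) s - val (val (0 : cocycle G R)) s = val (val z) s.
  have -> : val (0 : cocycle G R) = 0 by rewrite raddf0.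
  by rewrite cochain0 subr0.
rewrite -[0](raddf0 (class_of (G := G) (R := R))) class_of_eqP.
by split=> -[w zw]; exists w => s; rewrite -zw z0.
Qed.

Lemma cocycle_bar_diff (z : cocycle G R) s : bar_diff (val (val z)) s = 0.
Proof. by rewrite -val_coboundary cocycleP cochain0. Qed.

Lemma smooth_cochain (f : seq G -> R) : smooth f ->
  exists c : cochain G R, forall s, val c s = f (pprods 1%g s).
Proof.
move=> sf; have cj : continuous (idfun : G -> G) by move=> x; exact: cvg_id.
exists (exist _ (fun s => f (pprods 1%g (map idfun s)))
  (mem_set (smooth_continuous_cochain cj sf))) => s.
by rewrite /= map_id.
Qed.

Lemma bar_diff_linvariantT (f : seq G -> R) s : smooth f -> linvariant setT f ->
  bar_diff (fun s => f (pprods 1%g s)) s = hdiff f (pprods 1%g s).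
Proof.
move=> [f0 _ _] fT; apply: bar_diff_pprods => // x t _.
by rewrite -[RHS](fT x) // map_pprods mulg1.
Qed.

Lemma smooth_cocycle (f : seq G -> R) : smooth f -> linvariant setT f ->
  hdiff f =1 (fun=> 0) ->
  exists z : cocycle G R, forall s, val (val z) s = f (pprods 1%g s).
Proof.
move=> sf fT df; have [c cf] := smooth_cochain sf.
have dc : is_cocycle c.
  apply/eqP/cochain_inj => s; rewrite cochain0 val_coboundary.
  rewrite (_ : val c = fun s => f (pprods 1%g s)); last exact/funext.
  by rewrite bar_diff_linvariantT // df.
by exists (exist _ c dc).
Qed.

End Cocycles.

Section Restriction.
Variables (G : topologicalGroupType) (R : comNzRingType).
Hypothesis profG : profinite G.

(** This is [cocycle_extend] for [G] as a closed subgroup of itself. *)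
Lemma cocycle_homogeneous (z : cocycle G R) :
  exists f : seq G -> R, [/\ smooth f, linvariant setT f, hdiff f =1 (fun=> 0) &
    forall s, val (val z) s = f (pprods 1%g s)].
Proof.
have gT : subgroup [set: G] by exact: subgroupP.
pose T := ClosedSubgroup gT (@closedT G).
pose i : continuousHomType T G := @subgroup_incl G T.
have [f [sf fT df fz]] := cocycle_extend profG
  (cocycle_bar_diff (cocycle_pullback i z)).
exists f; split=> // s.
have -> : s = words_val (map (fun x => exist _ x (mem_set I) : T) s).
  by rewrite /words_val -map_comp map_id.
exact/esym/fz.
Qed.

Lemma map_conj_pprods (g : G) s :
  pprods 1%g (map (fun x => g * x * g^-1)%g s) =
  map (fun x => g * x * g^-1)%g (pprods 1%g s).
Proof.
rewrite -{1}[1%g](_ : g * 1 * g^-1 = _)%g; last by rewrite mulg1 mulgV.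
elim: s 1%g => // x s IH a; rewrite map_cons !pprods_cons map_cons -IH.
by congr (_ :: pprods _ _); rewrite !mulgA mulgVK.
Qed.

Variable S : closedSubgroup G.
Let res : {rmorphism continuous_cohomology G R -> continuous_cohomology S R} :=
  pullback (@subgroup_incl G S : continuousHomType S G).

(** Right multiplication by [g] commutes with left multiplication by [P], so its
    prism homotopy restricts to [P].  Followed by left multiplication by [g^-1],
    it is conjugation by [g^-1]. *)
Lemma conj_restriction (f : seq G -> R) (P : closedSubgroup G) (g : G) :
  smooth f -> linvariant P f -> hdiff f =1 (fun=> 0) ->
  exists w : cochain P R, forall s : seq P,
    f (map (fun x => x * g)%g (pprods 1%g (words_val s))) -
      f (pprods 1%g (words_val s)) = bar_diff (val w) s.
Proof.
move=> sf fP df; have [f0 _ [N nN fN]] := sf.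
have gN x y : coset N x = coset N y -> coset N (x * g)%g = coset N (y * g)%g.
  by move=> xy; exact: cosetM.
have sp := smooth_prism sf nN fN gN.
exists (restriction_cochain P sp) => s.
rewrite bar_diff_restriction; last first.
- by apply: (linvariant_prism nN fN fP) => // v x _; rewrite mulgA.
- by case: sp.
by rewrite -hdiff_prism [X in _ + X]prism0 // addr0.
Qed.

Lemma res_stable (x : continuous_cohomology G R) :
  is_stable (fusion_system S) (res x).
Proof.
have [z ->] := class_of_surj x; move=> P PS phi [_ _ [g [gPS phiE]]].
rewrite /res /= !pullback_class; apply/class_of_eqP.
have [f [sf fT df fz]] := cocycle_homogeneous z.
have [w wf] := conj_restriction (P := P) (g^-1)%g sf (linvariantS (@subsetT _ _) fT) df.
exists w => s; rewrite -wf !val_cocycle_pullback !fz; congr (_ - _).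
  rewrite -[RHS](fT g) //.
  have -> : map phi s = map (conj_hom gPS) s by apply: eq_map => y; exact: phiE.
  have -> t : map (fun x => g * x)%g (map (fun x => x * g^-1)%g t) =
      map (fun x => g * x * g^-1)%g t.
    by rewrite -map_comp; apply: eq_map => y /=; rewrite mulgA.
  rewrite -map_conj_pprods; congr (f (pprods _ _)).
  by rewrite /words_val -!map_comp.
by congr (f (pprods _ _)); rewrite -map_comp.
Qed.

(* For a Sylow subgroup [S] and [R] the field with [p] elements, this is
   [sylow_index_unit]. *)
Hypothesis index_unit : forall N : set G, open_normal N ->
  exists n (r : 'I_n -> G) (k : R),
    [/\ forall x, exists i, coset (thicken S N) (r i) x,
        forall i j, coset (thicken S N) (r i) (r j) -> i = j & k * n%:R = 1].

Let gS : subgroup S := closedSubgroup_subgroup S.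

Lemma res_ker (x : continuous_cohomology G R) : res x = 0 -> x = 0.
Proof.
have [z ->] := class_of_surj x.
have [f [sf fT df fz]] := cocycle_homogeneous z.
rewrite /res /= pullback_class => /class_of_eq0P[w zw].
have fS := linvariantS (@subsetT _ S) fT.
have [|h [sh hS dh]] := restriction_exact profG (w := w) sf fS df.
  by move=> s; rewrite -zw val_cocycle_pullback fz.
have [_ _ [N nN hN]] := sh; have hU := linvariant_thicken nN hN hS.
have gU := subgroup_thicken nN gS.
have [n [r [k [r_cover r_inj kn]]]] := index_unit nN.
pose c s := k * transfer r h s.
have sc : smooth c by apply: smoothZ; exact: smooth_transfer.
have cT : linvariant setT c.
  by move=> g _ s; rewrite /c (linvariant_transfer gU r_cover r_inj hU).
have dc s : hdiff c s = f s.
  rewrite hdiffZ hdiff_transfer.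
  rewrite (_ : hdiff h = f); last exact/funext.
  by rewrite transferT // mulrA kn mul1r.
apply/class_of_eq0P.
have [c' c'E] := smooth_cochain sc; exists c' => s.
rewrite (_ : val c' = fun s => c (pprods 1%g s)); last exact/funext.
by rewrite bar_diff_linvariantT // dc fz.
Qed.

(** Stability is applied to conjugation by [g^-1] on the intersection [P] of [S]
    and [g S g^-1].  By [conj_restriction] it says that [f (g^-1 _) - f], which is
    invariant under [P], restricts to a coboundary of [P]; then
    [restriction_exact] applies. *)
Lemma stable_homotopy (z : cocycle S R) (f : seq G -> R) (g : G) :
  is_stable (fusion_system S) (class_of z) ->
  smooth f -> linvariant S f -> hdiff f =1 (fun=> 0) ->
  restriction f =1 val (val z) ->
  exists h, [/\ smooth h, linvariant [set u | (S : set G) u /\ (S : set G) (g^-1 * u * g)%g] h &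
    forall s, hdiff h s = f (map (fun x => g^-1 * x)%g s) - f s].
Proof.
move=> stz sf fS df fz.
have cg : continuous (fun u : G => g^-1 * u * g)%g.
  apply: continuous_mulg; last exact: cst_continuous.
  by apply: continuous_mulg; [exact: cst_continuous|move=> x; exact: cvg_id].
pose A := [set u | (S : set G) u /\ (S : set G) (g^-1 * u * g)%g].
have cA : closed A.
  apply: closedI; first exact: closedSubgroup_closed.
  by apply: (closed_comp (f := fun u : G => g^-1 * u * g)%g) => //; exact: closedSubgroup_closed.
have gA : subgroup A.
  apply: subgroupP.
  - by split; rewrite ?mulg1 ?mulVg; exact: subgroup1.
  - move=> x y [Sx Sxg] [Sy Syg]; split; first exact: subgroupM.
    have := subgroupM gS Sxg Syg; rewrite !mulgA mulgK; exact.
  - move=> x [Sx Sxg]; split; first exact: subgroupV.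
    by have := subgroupV gS Sxg; rewrite !invgM invgK !mulgA.
pose P := ClosedSubgroup gA cA.
have PS : P `<=` S by move=> x [].
have gPS : conjugates_into (g^-1)%g P S by move=> x [_]; rewrite invgK.
have Fphi : fusion_system S (conj_hom gPS : continuousHomType P S).
  by split=> //; exists (g^-1)%g, gPS.
have := stz P PS _ Fphi; rewrite !pullback_class => /class_of_eqP[w zw].
pose f' s := f (map (fun x => g^-1 * x)%g s).
have sf' : smooth f' by exact: smooth_translate.
have f'P : linvariant P f'.
  move=> u [_ Su] s; rewrite /f' -[RHS](fS _ Su) -!map_comp.
  by congr f; apply: eq_map => x /=; rewrite !mulgA mulgK.
have df' : hdiff f' =1 (fun=> 0) by move=> s; rewrite /f' hdiff_map df.
have [v vf'] := conj_restriction (P := P) g sf' f'P df'.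
have [||||h [sh hP dh]] := restriction_exact (P := P) (f := fun s => f' s - f s) profG (w := w - v).
- exact: smoothB.
- by move=> u Pu s; rewrite f'P // (fS u) //; exact: (PS _ Pu).
- by move=> s; rewrite hdiffB df' df subrr.
- move=> s; rewrite -val_coboundary raddfB cochainB !val_coboundary -zw -vf'.
  rewrite !val_cocycle_pullback -!fz /restriction /f'.
  have -> : words_val (map (conj_hom gPS) s) = map (fun x => g^-1 * x * g^-1^-1)%g (words_val s).
    by rewrite /words_val -!map_comp.
  have -> : words_val (map (incl_hom PS) s) = words_val s.
    by rewrite /words_val -!map_comp.
  rewrite map_conj_pprods invgK.
  have -> t : map (fun x => g^-1 * x)%g (map (fun x => x * g)%g t) =
      map (fun x => g^-1 * x * g)%g t.
    by rewrite -map_comp; apply: eq_map => y /=; rewrite mulgA.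
  ring.
by exists h.
Qed.

Lemma res_stable_surj (y : continuous_cohomology S R) :
  is_stable (fusion_system S) y -> exists x, res x = y.
Proof.
have [z ->] := class_of_surj y => stz.
have [f [sf fS df fz]] := cocycle_extend profG (cocycle_bar_diff z).
have [N [nN fN psi]] := uniform_homotopy profG (@closedSubgroup_closed _ S) sf
  (fun g => stable_homotopy g stz sf fS df fz).
have gU := subgroup_thicken nN gS.
have fU := linvariant_thicken nN fN fS.
have [n [r [k [r_cover r_inj kn]]]] := index_unit nN.
have [h [sh hU dh]] := transfer_homotopy gU r_cover r_inj fU psi.
pose c s := k * transfer r f s.
have sc : smooth c by apply: smoothZ; exact: smooth_transfer.
have cT : linvariant setT c.
  by move=> g _ s; rewrite /c (linvariant_transfer gU r_cover r_inj fU).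
have dc : hdiff c =1 (fun=> 0).
  by move=> s; rewrite hdiffZ hdiff_transfer /transfer big1 ?mulr0.
have [x xc] := smooth_cocycle sc cT dc.
exists (class_of x); rewrite /res /= pullback_class; apply/class_of_eqP.
have sh' : smooth (fun s => k * h s) by exact: smoothZ.
exists (restriction_cochain S sh') => s.
rewrite bar_diff_restriction; last first.
- move=> u Su t; rewrite hU //; exact: sub_thicken.
- by case: sh'.
rewrite val_cocycle_pullback xc -fz /restriction hdiffZ dh /c mulrBr mulrA kn mul1r.
by [].
Qed.

End Restriction.

Lemma sylow_index_unit (p : nat) (G : topologicalGroupType) (S : closedSubgroup G)
    (N : set G) : prime p -> sylow p S -> open_normal N ->
  exists n (r : 'I_n -> G) (k : 'F_p),
    [/\ forall x, exists i, coset (thicken S N) (r i) x,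
        forall i j, coset (thicken S N) (r i) (r j) -> i = j & k * n%:R = 1].
Proof.
move=> p_prime [_ indexS] nN.
have gU := subgroup_thicken nN (closedSubgroup_subgroup S).
have [n idx pn] := indexS _ (open_thicken S nN) gU (sub_thicken nN).
have [r [r_cover r_inj]] := index_transversal gU idx.
exists n, r, (n%:R)^-1; split=> //; apply: mulVf.
by rewrite -(dvdn_pcharf (pchar_Fp p_prime)).
Qed.

Theorem theorem1p2 (p : nat) (p_prime : prime p) (G : topologicalGroupType)
    (G_profinite : profinite G) (S : closedSubgroup G) (S_sylow : sylow p S) :
  exists f : {rmorphism continuous_cohomology G 'F_p ->
                        stable_cohomology S (fusion_system S) 'F_p},
    bijective f.
Proof.
pose H := continuous_cohomology G 'F_p.
pose HF := stable_cohomology S (fusion_system S) 'F_p.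
pose res : {rmorphism H -> continuous_cohomology S 'F_p} :=
  pullback (@subgroup_incl G S : continuousHomType S G).
have idx N := @sylow_index_unit p G S N p_prime S_sylow.
pose f (x : H) : HF := exist _ (res x) (mem_set (res_stable G_profinite x)).
have fB : zmod_morphism f.
  by move=> x y; apply: val_inj; rewrite [RHS]raddfB; exact: (raddfB res).
have fM : monoid_morphism f.
  split=> [|x y]; apply: val_inj; first exact: (rmorph1 res).
  by rewrite [RHS]rmorphM; exact: (rmorphM res).
pose F : {rmorphism H -> HF} := HB.pack f (GRing.isZmodMorphism.Build H HF f fB)
  (GRing.isMonoidMorphism.Build H HF f fM).
have F_inj : injective F.
  apply: raddf_inj => x Fx0; apply: (res_ker G_profinite idx).
  by rewrite -[LHS]/(val (F x)) Fx0 raddf0.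
have F_surj y : exists x, F x = y.
  have [x xy] := res_stable_surj G_profinite idx (set_mem (valP y)).
  by exists x; apply: val_inj.
exists F; have [g gK] := choice F_surj.
by exists g => // x; apply: F_inj.
Qed.
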